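(* Let $P$ be a $d$-polytope with fewer than $2d$ vertices, of which at most $d-1$ are nonsimple. Then $P$ is a pyramid.
   Context: A $d$-polytope is a convex polytope of dimension $d$. Its graph has the vertices and edges ($1$-faces) of the polytope as vertices and edges. A vertex of a $d$-polytope is simple if its degree in the graph is exactly $d$ (equivalently, it lies in exactly $d$ facets), and nonsimple otherwise. A polytope $P$ is a pyramid if it is the convex hull of a facet $F$ (the basis) and one further vertex $u$ not in $F$ (the apex). *)

(* Defs.v *)
From HB Require Import structures.
From mathcomp Require Import all_boot all_order all_algebra.
From mathcomp Require Import all_classical all_reals all_analysis.

Set Implicit Arguments.
Unset Strict Implicit.
Unset Printing Implicit Defensive.

Import Order.TTheory GRing.Theory Num.Theory.

Local Open Scope classical_set_scope.
Local Open Scope card_scope.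
Local Open Scope ring_scope.

Section Polytopes.
Variables (R : realType) (n : nat).
Implicit Types (A P F e : set 'rV[R]_n) (u v x y : 'rV[R]_n) (d k : nat).

Definition affine_set A : Prop :=
  forall x y (t : R), A x -> A y -> A (t *: x + (1 - t) *: y).

Definition affine_hull A : set 'rV[R]_n := smallest affine_set A.

Definition convex_hull A : set 'rV[R]_n := smallest (@convex_set R 'rV[R]_n) A.

(* The dimension is a relation: a nonempty set has exactly one dimension, and
   the empty set (conventionally of dimension -1) has none. *)
Definition has_dim k A : Prop :=
  exists (x0 : 'rV[R]_n) (W : {vspace 'rV[R]_n}),
    affine_hull A = [set x | x - x0 \in W] /\ \dim W = k.

Definition polytope P : Prop :=
  exists S : set 'rV[R]_n, finite_set S /\ P = convex_hull S.

Definition dpolytope d P : Prop := polytope P /\ has_dim d P.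

(* F is the set of points of P attaining equality in a linear inequality
   x *m a <= b valid on P; a = 0 yields the improper faces P and set0. *)
Definition face P F : Prop :=
  exists (a : 'cV[R]_n) (b : R),
    (forall x, P x -> (x *m a) 0 0 <= b) /\
    F = [set x | P x /\ (x *m a) 0 0 = b].

Definition kface k P F : Prop := face P F /\ has_dim k F.

(* As the empty set has no dimension here, a single point has no facet. *)
Definition facet P F : Prop := exists k, has_dim k.+1 P /\ kface k P F.

Definition vertices P : set 'rV[R]_n := [set v | kface 0 P [set v]].

Definition edges P : set (set 'rV[R]_n) := [set e | kface 1 P e].

Definition incident_edges P v : set (set 'rV[R]_n) :=
  [set e | edges P e /\ e v].

Definition simple_vertices d P : set 'rV[R]_n :=
  [set v | vertices P v /\ incident_edges P v #= `I_d].

Definition nonsimple_vertices d P : set 'rV[R]_n :=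
  vertices P `\` simple_vertices d P.

Definition pyramid_over P F u : Prop :=
  [/\ facet P F, vertices P u, ~ F u & P = convex_hull (F `|` [set u])].

Definition pyramid P : Prop := exists F u, pyramid_over P F u.

End Polytopes.

(* Main.v *)
Require Import Defs.
From HB Require Import structures.
From mathcomp Require Import all_classical all_reals all_analysis.
From mathcomp Require Import all_boot all_order all_algebra.
From mathcomp Require Import ring lra.

(** Let P be a d-polytope with fewer than 2d vertices, at most d-1 of them
nonsimple. As P has more than d vertices, some vertex v is simple. The d edges
at v give affine coordinates in which v is the origin, its neighbours w_1, ...,
w_d are the unit vectors and P lies in the nonnegative orthant. A coordinate
which vanishes at every vertex except w_j exhibits P as a pyramid with apex w_j
over the facet x_j = 0 ([apex_pyramid]), so the theorem is a statement about
the coordinates of the vertices of P, and only those matter from then on.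

For a set K of axes let P_K be the face of P spanned by v and the axes in K.
Claim ([apex_exists]): if P_K has fewer than 2|K| vertices and fewer than |K|
nonsimple ones, then some j in K is such that x_j vanishes at all vertices of
P_K except w_j. This is proved by induction on |K|; the origin v never changes.
Suppose that no such j exists.

 - Some w_u with u in K is simple. If its neighbours in P_K were only v and the
   other w_k, then P_K would be a simplex; so there is a vertex z in a plane
   spanned by the axes u and j, off both axes ([plane_vertex]).

 - Each facet P_(K-i) of P_K misses at least two vertices, so the induction
   hypothesis applies to it unless all nonsimple vertices of P_K lie in it. If it
   applies, P_(K-i) has an apex w_q. When i is neither u nor j, the face contains
   z, hence q is neither u nor j; and w_q is nonsimple, because a simple apex has
   a simplex opposite to it ([simple_apex]). Consequently the induction
   hypothesis also applies to P_(K-q), and one can pass from i to q repeatedly.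

 - If it applies to no i other than u and j, then |K| > 2, as v, w_u, w_j and z
   would be too many vertices for |K| = 2, and P_K has |K|-1 nonsimple vertices,
   all in the plane of the axes u and j. Together with v and w_u these leave at
   most |K|-2 vertices outside that plane, and among the generators of the cone
   of P_K at a vertex in the plane at most two lie in the plane. So every vertex
   in the plane is simple ([plane_fsimple]), a contradiction.

 - Otherwise, following i to q until the set of vertices with x_i = 0 stops
   growing yields a set C of at least two axes, with w_c nonsimple for c in C,
   such that every vertex of P_K other than these w_c has either all or none of
   its coordinates in C equal to 0. [no_block] then shows that each vertex of P_K
   lies in Q = P_(K-C) or is one of the w_c, that is, P_K is the join of Q and
   the simplex of the w_c; so each w_c with c in C is an apex of P_K,
   a contradiction.

The last step is where the bound on nonsimple vertices is essential. The face Q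
has fewer than dim Q nonsimple vertices, since the w_c are not in Q, so each
facet of Q contains a simple vertex x. At x the edges leaving Q lead exactly to
the w_c ([block_tangent]), and therefore a vertex t of P_K, after removal of its
components along the w_c, satisfies the inequalities of all facets of Q through
x. As this covers all facets of Q, it puts t in the join. To have this also when
the components of t along C sum to 1 or more, the argument takes place in the
cone over Q in homogeneous coordinates.

The convex geometry needed is Farkas' lemma and two refinements of it: a violated
inequality may be taken to define a facet ([facet_functional]), and a vector which
is a member of a minimal set of generators of a pointed cone spans an exposed ray
([gordan]). The latter shows that the minimal generators at a vertex of P are
edges of P, whence a simple vertex has at most d of them
([simple_generators]). *)

Set Implicit Arguments.
Unset Strict Implicit.
Unset Printing Implicit Defensive.

Import Order.TTheory GRing.Theory Num.Theory.
Local Open Scope ring_scope.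

(** * Cones in coordinate space: Farkas' lemma and its refinements *)

Section Cones.
Variable R : realFieldType.
Implicit Types n : nat.

Definition ev n (phi : 'cV[R]_n) (a : 'rV[R]_n) : R := (a *m phi) 0 0.

Lemma ev_is_linear n (phi : 'cV[R]_n) : linear (ev phi : 'rV[R]_n -> R^o).
Proof. by move=> t x y; rewrite /ev mulmxDl -scalemxAl !mxE. Qed.

HB.instance Definition _ n (phi : 'cV[R]_n) :=
  GRing.isLinear.Build R 'rV[R]_n R^o _ (ev phi) (ev_is_linear phi).

Lemma evZ n (phi : 'cV[R]_n) t a : ev phi (t *: a) = t * ev phi a.
Proof. exact: linearZ. Qed.

Lemma evDl n (phi psi : 'cV[R]_n) a : ev (phi + psi) a = ev phi a + ev psi a.
Proof. by rewrite /ev mulmxDr mxE. Qed.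

Lemma evZl n (phi : 'cV[R]_n) t a : ev (t *: phi) a = t * ev phi a.
Proof. by rewrite /ev -scalemxAr mxE. Qed.

Lemma evNl n (phi : 'cV[R]_n) a : ev (- phi) a = - ev phi a.
Proof. by rewrite /ev mulmxN mxE. Qed.

Lemma ev_suml n (J : finType) (F : J -> 'cV[R]_n) (S : {set J}) a :
  ev (\sum_(j in S) F j) a = \sum_(j in S) ev (F j) a.
Proof. by rewrite /ev mulmx_sumr summxE. Qed.

Lemma ev_sum n (phi : 'cV[R]_n) (I : finType) (S : {set I}) c (a : I -> 'rV_n) :
  ev phi (\sum_(i in S) c i *: a i) = \sum_(i in S) c i * ev phi (a i).
Proof. by rewrite linear_sum; apply: eq_bigr => i _; exact: evZ. Qed.

Definition cone (I : finType) n (S : {set I}) (a : I -> 'rV[R]_n) T : Prop :=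
  exists2 c : I -> R, (forall i, 0 <= c i) & T = \sum_(i in S) c i *: a i.

Lemma cone0 (I : finType) n (S : {set I}) (a : I -> 'rV[R]_n) : cone S a 0.
Proof. by exists (fun=> 0) => //; rewrite big1 // => i _; rewrite scale0r. Qed.

Lemma cone_gen (I : finType) n (S : {set I}) (a : I -> 'rV[R]_n) i :
  i \in S -> cone S a (a i).
Proof.
move=> iS; exists (fun j => (j == i)%:R) => [j|]; first exact: ler0n.
rewrite (bigD1 i) //= eqxx scale1r big1 ?addr0 // => j /andP[_ /negPf->].
by rewrite scale0r.
Qed.

Lemma coneD (I : finType) n (S : {set I}) (a : I -> 'rV[R]_n) x y :
  cone S a x -> cone S a y -> cone S a (x + y).
Proof.
move=> [c c0 ->] [e e0 ->]; exists (fun i => c i + e i).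
  by move=> i; rewrite addr_ge0.
by rewrite -big_split; apply: eq_bigr => i _; rewrite scalerDl.
Qed.

Lemma coneZ (I : finType) n (S : {set I}) (a : I -> 'rV[R]_n) t x :
  0 <= t -> cone S a x -> cone S a (t *: x).
Proof.
move=> t0 [c c0 ->]; exists (fun i => t * c i).
  by move=> i; rewrite mulr_ge0.
by rewrite scaler_sumr; apply: eq_bigr => i _; rewrite scalerA.
Qed.

Lemma cone_sum (I J : finType) n (S : {set I}) (a : I -> 'rV[R]_n)
    (A : {set J}) (F : J -> 'rV[R]_n) :
  (forall j, j \in A -> cone S a (F j)) -> cone S a (\sum_(j in A) F j).
Proof.
move=> h; elim/big_ind: _ => //; [exact: cone0|exact: coneD].
Qed.

Lemma cone_trans (I J : finType) n (S : {set I}) (a : I -> 'rV[R]_n)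
    (A : {set J}) (b : J -> 'rV[R]_n) T :
  (forall j, j \in A -> cone S a (b j)) -> cone A b T -> cone S a T.
Proof.
by move=> h [c c0 ->]; apply: cone_sum => j jA; apply: coneZ => //; apply: h.
Qed.

(** Bartl's proof, by induction on the number of generators: if dropping a m from
the generators destroys the hypothesis, some psi is nonnegative on the other
generators and negative on T and on a m; projecting along a m onto the kernel of
psi leaves one generator less. *)
Lemma farkas (I : finType) n (S : {set I}) (a : I -> 'rV[R]_n) T :
  (forall phi, (forall i, i \in S -> 0 <= ev phi (a i)) -> 0 <= ev phi T) ->
  cone S a T.
Proof.
move: {2}#|S| (erefl #|S|) => k; elim: k S a T => [|k IH] S a T cS h.
  have S0 : S = set0 by apply/eqP; rewrite -cards_eq0 cS.
  suff -> : T = 0 by exact: cone0.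
  apply/rowP => j; rewrite mxE; apply/eqP; rewrite eq_le.
  have evj s : ev (s *: delta_mx j 0) T = s * T 0 j.
    rewrite evZl /ev mxE (bigD1 j) //= big1 ?addr0 ?mxE ?eqxx ?mulr1 //.
    by move=> l /negPf lj; rewrite !mxE lj mulr0.
  have := h (1 *: delta_mx j 0); have := h (-1 *: delta_mx j 0).
  rewrite !evj mul1r mulN1r oppr_ge0 => h1 h2.
  by rewrite h1 ?h2 // => i; rewrite S0 inE.
have [m mS] : exists m, m \in S by apply/set0Pn; rewrite -cards_eq0 cS.
have cS' : #|S :\ m| = k by move: cS; rewrite (cardsD1 m) mS => -[].
have split_m (F : I -> 'rV[R]_n) :
    \sum_(i in S) F i = F m + \sum_(i in S :\ m) F i.
  by rewrite (big_setD1 m).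
have [h'|] := pselect (forall phi,
    (forall i, i \in S :\ m -> 0 <= ev phi (a i)) -> 0 <= ev phi T).
  apply: (cone_trans _ (IH _ a T cS' h')) => i /setD1P[_ iS]; exact: cone_gen.
case/existsNP => psi /not_implyP[psi_ge0 /negP]; rewrite -ltNge => psiT.
have psim : ev psi (a m) < 0.
  rewrite ltNge; apply/negP => pm; move: psiT; rewrite ltNge h // => i iS.
  by have [->//|im] := eqVneq i m; apply: psi_ge0; rewrite !inE im.
(* q is the projection along a m onto the kernel of psi *)
pose r x := ev psi x / ev psi (a m).
pose q x := x - r x *: a m.
have evq phi x : ev phi (q x) = ev (phi - (ev phi (a m) / ev psi (a m)) *: psi) x.
  rewrite /q linearB /= evZ evDl evNl evZl /r; congr (_ - _).
  by rewrite mulrAC mulrC -mulrA; ring.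
have pm0 : ev psi (a m) != 0 by rewrite lt_eqF.
case: (IH (S :\ m) (q \o a) (q T) cS') => [phi phi_ge0|c c0 e].
  rewrite evq; apply: h => i iS; have [->|im] := eqVneq i m.
    by rewrite -evq /q /r divff // scale1r subrr linear0.
  by rewrite -evq; apply: phi_ge0; rewrite !inE im.
pose s := r T - \sum_(i in S :\ m) c i * r (a i).
have s0 : 0 <= s.
  rewrite subr_ge0; apply: (@le_trans _ _ 0).
    apply: sumr_le0 => i iS; rewrite mulr_ge0_le0 // /r.
    by rewrite ler_ndivrMr // mul0r psi_ge0.
  by rewrite /r ler_ndivlMr // mul0r ltW.
exists (fun i => if i == m then s else c i) => [i|]; first by case: ifP.
rewrite split_m eqxx.
have -> : T = q T + r T *: a m by rewrite /q subrK.
rewrite e (eq_bigr (fun i => c i *: a i - (c i * r (a i)) *: a m)); last first.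
  by move=> i _; rewrite /= /q scalerBr scalerA.
rewrite sumrB -scaler_suml addrAC -addrA -scalerBl -/s addrC; congr (_ + _).
by apply: eq_bigr => i /setD1P[/negPf->].
Qed.

Definition family (I : finType) n (A : {set I}) (a : I -> 'rV[R]_n) :
  'M[R]_(#|A|, n) := \matrix_(i < #|A|) a (enum_val i).

Lemma family_sub (I : finType) n (A : {set I}) (a : I -> 'rV[R]_n) i :
  i \in A -> (a i <= family A a)%MS.
Proof.
move=> iA; have := row_sub (enum_rank_in iA i) (family A a).
by rewrite rowK enum_rankK_in.
Qed.

Lemma cone_family (I : finType) n (A : {set I}) (a : I -> 'rV[R]_n) T :
  cone A a T -> (T <= family A a)%MS.
Proof.
by move=> [c _ ->]; apply: summx_sub => i iA; apply/scalemx_sub/family_sub.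
Qed.

(** Used to bound from below the number of vertices in a facet and of generators at a
vertex. *)
Lemma leq_span n m (L : {set 'I_n}) (B : 'M[R]_(m, n)) :
  (forall l, l \in L -> ((delta_mx 0 l : 'rV[R]_n) <= B)%MS) -> (#|L| <= m)%N.
Proof.
move=> h; pose E := family L (fun l : 'I_n => delta_mx 0 l : 'rV[R]_n).
have fE : row_free E.
  apply/row_freeP; exists E^T; apply/matrixP => i j.
  rewrite !mxE (bigD1 (enum_val i)) //= !mxE !eqxx mul1r (inj_eq enum_val_inj).
  rewrite eq_sym big1 ?addr0 1?eq_sym // => l /negPf li.
  by rewrite !mxE /= li mul0r.
rewrite -(eqP fE) (leq_trans _ (rank_leq_row B)) // mxrankS //.
by apply/row_subP => i; rewrite rowK h // enum_valP.
Qed.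

(** A functional separating T from the cone can be chosen so that the generators
on which it vanishes span, together with T, all generators; when T is in the span
of the generators, its kernel thus contains a facet of the cone. Among the
separating functionals take one which vanishes on as many generators as possible:
if some generator a i0 were not in that span, the functional could be tilted
within the functionals vanishing on the span until a further generator is
reached. *)
Lemma facet_functional (I : finType) n (S : {set I}) (a : I -> 'rV[R]_n) T :
  ~ cone S a T ->
  exists phi : 'cV[R]_n, [/\ forall i, i \in S -> 0 <= ev phi (a i), ev phi T < 0 &
    forall i, i \in S ->
      (a i <= col_mx T (family [set j in S | ev phi (a j) == 0] a))%MS].
Proof.
move=> nT; pose Z (phi : 'cV[R]_n) := [set j in S | ev phi (a j) == 0].
pose good phi := (forall i, i \in S -> 0 <= ev phi (a i)) /\ ev phi T < 0.
have ex : exists k, `[< exists2 phi, good phi & #|Z phi| = k >].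
  have [phi gphi] : exists phi, good phi.
    apply: contrapT => /forallNP h; apply: nT; apply: farkas => phi phi0.
    by rewrite leNgt; apply/negP => phiT; apply: (h phi).
  by exists #|Z phi|; apply/asboolP; exists phi.
case: (@ex_maxnP _ #|S| ex) => [k /asboolP[phi _ <-]|].
  by apply: subset_leq_card; apply/subsetP => i; rewrite inE => /andP[].
move=> k /asboolP[phi [phi0 phiT] <-] kmax; exists phi; split=> // i0 i0S.
rewrite submxE; apply: contrapT => /negP; rewrite -/(Z phi).
set C := cokermx _ => /eqP nz.
have [j nzj] : exists j, (a i0 *m C) 0 j != 0.
  apply: contrapT => /forallNP h; apply: nz; apply/rowP => j.
  by rewrite [RHS]mxE; apply/eqP; move: (h j) => /negP; rewrite negbK.
pose psi0 := col j C.
have psi0E x : ev psi0 x = (x *m C) 0 j.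
  by rewrite /ev !mxE; apply: eq_bigr => l _; rewrite mxE.
have psi00 x : (x <= col_mx T (family (Z phi) a))%MS -> ev psi0 x = 0.
  by rewrite submxE psi0E => /eqP ->; rewrite mxE.
have [psi [psii psiT psiZ]] : exists psi : 'cV[R]_n, [/\ ev psi (a i0) < 0,
    ev psi T = 0 & forall i, i \in Z phi -> ev psi (a i) = 0].
  have psi0T : ev psi0 T = 0 by apply: psi00; rewrite -addsmxE addsmxSl.
  have psi0Z i : i \in Z phi -> ev psi0 (a i) = 0.
    move=> iZ; apply: psi00; apply: submx_trans (family_sub a iZ) _.
    by rewrite -addsmxE addsmxSr.
  move: nzj; rewrite -psi0E neq_lt => /orP[lt0|gt0]; first by exists psi0.
  exists (- psi0); split; rewrite ?evNl ?oppr_lt0 ?psi0T ?oppr0 // => i iZ.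
  by rewrite evNl psi0Z ?oppr0.
pose P i := (i \in S) && (ev psi (a i) < 0).
pose F i := ev phi (a i) / - ev psi (a i).
have Pi0 : P i0 by rewrite /P i0S.
case: (arg_minP F Pi0) => i1 /andP[i1S psi1] Fmin.
have psi1' : 0 < - ev psi (a i1) by rewrite oppr_gt0.
have F0 : 0 <= F i1 by rewrite divr_ge0 ?phi0 // ltW.
pose phi' := phi + F i1 *: psi.
have evphi' x : ev phi' x = ev phi x + F i1 * ev psi x by rewrite evDl evZl.
have : (#|Z phi'| <= #|Z phi|)%N.
  apply: kmax; apply/asboolP; exists phi' => //; split; last first.
    by rewrite evphi' psiT mulr0 addr0.
  move=> i iS; rewrite evphi'.
  have [psi_ge0|psi_lt0] := leP 0 (ev psi (a i)).
    by rewrite addr_ge0 ?phi0 // mulr_ge0.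
  rewrite -[ev psi _]opprK mulrN subr_ge0 -ler_pdivlMr ?oppr_gt0 //.
  by apply: Fmin; rewrite /P iS.
rewrite leqNgt => /negP; apply; apply: proper_card; apply/properP; split.
  apply/subsetP => i iZ; have := psiZ i iZ; move: iZ.
  by rewrite !inE evphi' => /andP[-> /eqP->] ->; rewrite mulr0 addr0 eqxx.
exists i1; rewrite !inE i1S /=.
  by rewrite evphi' /F invrN mulrN mulNr divfK ?subrr // lt_eqF.
by apply/negP => e; move: psi1; rewrite psiZ ?ltxx // !inE i1S.
Qed.

(** Gordan's theorem modulo the line of g. With g = 0 it exposes a vertex of a
polytope, and with g a generator at a vertex it exposes an edge. *)
Lemma gordan (I : finType) n (S : {set I}) (h : I -> 'rV[R]_n) (g : 'rV[R]_n) :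
  (forall (c : I -> R) t, (forall i, 0 <= c i) ->
     \sum_(i in S) c i *: h i = t *: g -> forall i, i \in S -> c i = 0) ->
  exists2 phi : 'cV[R]_n, ev phi g = 0 & forall i, i \in S -> 0 < ev phi (h i).
Proof.
move=> indep; pose C := cokermx g.
have one k : k \in S -> exists phi : 'cV[R]_n,
    [/\ ev phi g = 0, forall i, i \in S -> 0 <= ev phi (h i) & 0 < ev phi (h k)].
  move=> kS.
  have : ~ cone S (fun i => h i *m C) (- (h k *m C)).
    move=> [c c0 /esym/eqP]; rewrite -addr_eq0.
    pose e i := c i + (i == k)%:R.
    have e0 i : 0 <= e i by rewrite addr_ge0 ?ler0n.
    have -> : \sum_(i in S) c i *: (h i *m C) + h k *m C =
        (\sum_(i in S) e i *: h i) *m C.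
      rewrite mulmx_suml (bigD1 k) //= [in RHS](bigD1 k) //= /e eqxx.
      rewrite scalerDl scale1r mulmxDl -scalemxAl addrAC; congr (_ + _).
      by apply: eq_bigr => i /andP[_ /negPf->]; rewrite addr0 scalemxAl.
    rewrite -submxE => /sub_rVP[t /(indep e t e0)/(_ k kS)/eqP].
    by rewrite /e eqxx gt_eqF // ltr_wpDl.
  move=> /facet_functional[phi [phi0 phik _]]; exists (C *m phi).
  have evC x : ev (C *m phi) x = ev phi (x *m C) by rewrite /ev mulmxA.
  split=> [|i iS|]; rewrite evC.
  - by rewrite mulmx_coker linear0.
  - exact: phi0.
  - by move: phik; rewrite linearN /= oppr_lt0.
have /choice[Phi hPhi] : forall k, exists phi : 'cV[R]_n, k \in S ->
    [/\ ev phi g = 0, forall i, i \in S -> 0 <= ev phi (h i) & 0 < ev phi (h k)].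
  by move=> k; case: (boolP (k \in S)) => [/one[phi ?]|_]; [exists phi|exists 0].
exists (\sum_(k in S) Phi k) => [|i iS]; rewrite ev_suml.
  by rewrite big1 // => k /hPhi[].
rewrite (bigD1 i) //= ltr_pwDl //; first by case: (hPhi i iS).
by apply: sumr_ge0 => k /andP[/hPhi[_ /(_ i iS)]].
Qed.

Lemma minimal_generators (I : finType) n (S : {set I}) (a : I -> 'rV[R]_n) :
  exists M : {set I}, [/\ M \subset S, forall i, i \in S -> cone M a (a i) &
    forall g, g \in M -> ~ cone (M :\ g) a (a g)].
Proof.
pose gen (M : {set I}) :=
  (M \subset S) && `[< forall i, i \in S -> cone M a (a i) >].
have genS : gen S.
  by rewrite /gen subxx; apply/asboolP => i; exact: cone_gen.
case: (minset_exists genS) => M /minsetP[/andP[MS /asboolP Mgen] Mmin] _.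
exists M; split=> // g gM gc.
have : M :\ g = M.
  apply: Mmin; last exact: subsetDl.
  rewrite /gen (subset_trans (subsetDl _ _) MS); apply/asboolP => i iS.
  apply: cone_trans (Mgen i iS) => j jM; have [->//|jg] := eqVneq j g.
  by apply: cone_gen; rewrite !inE jg.
by move/setP/(_ g); rewrite !inE eqxx gM.
Qed.

End Cones.

(** * Pointed cones and minimal generators *)

Section Pointed.
Variable R : realFieldType.

Definition pointed (I : finType) n (S : {set I}) (a : I -> 'rV[R]_n) : Prop :=
  forall c : I -> R, (forall i, 0 <= c i) -> \sum_(i in S) c i *: a i = 0 ->
  forall i, i \in S -> c i = 0.

Lemma pointed_sub (I : finType) n (S T : {set I}) (a : I -> 'rV[R]_n) :
  T \subset S -> pointed S a -> pointed T a.
Proof.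
move=> TS pS c c0 e i iT.
have := pS (fun j => if j \in T then c j else 0).
move=> /(_ _ _ i (subsetP TS i iT)); rewrite iT; apply=> [j|].
  by case: ifP.
rewrite -[RHS]e (big_setID T) /= (setIidPr TS) [X in _ + X]big1 ?addr0.
  by apply: eq_bigr => j ->.
by move=> j /setDP[_ /negPf->]; rewrite scale0r.
Qed.

(** This is the hypothesis of [gordan] for the generator g and the other
generators. *)
Lemma minimal_indep (I : finType) n (M : {set I}) (a : I -> 'rV[R]_n) g :
  pointed M a -> g \in M -> ~ cone (M :\ g) a (a g) ->
  forall (c : I -> R) t, (forall i, 0 <= c i) ->
  \sum_(i in M :\ g) c i *: a i = t *: a g -> forall i, i \in M :\ g -> c i = 0.
Proof.
move=> pM gM ng c t c0 e i iMg.
have [t0|t0] := ltP 0 t.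
  case: ng; exists (fun j => t^-1 * c j) => [j|].
    by rewrite mulr_ge0 // invr_ge0 ltW.
  under eq_bigr do rewrite -scalerA.
  by rewrite -scaler_sumr e scalerA mulVf ?scale1r // gt_eqF.
pose c' j := if j == g then - t else c j.
have c'0 j : 0 <= c' j by rewrite /c'; case: ifP; rewrite ?oppr_ge0.
have := pM c' c'0; rewrite (big_setD1 g) //= {1}/c' eqxx.
rewrite (eq_bigr (fun i => c i *: a i)) => [|j /setD1P[/negPf jg _]]; last first.
  by rewrite /c' jg.
case/setD1P: iMg => /negPf ig iM.
by rewrite e scaleNr addNr => /(_ erefl i iM); rewrite /c' ig.
Qed.

(** Three vectors in a plane are linearly dependent. Up to a global sign at most one
coefficient of the dependence is positive: if there is none the cone is not
pointed, and if there is one its vector lies in the cone of the other two. *)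
Lemma minimal_plane (I : finType) n (M A : {set I}) (a : I -> 'rV[R]_n)
    (B : 'M[R]_(2, n)) :
  pointed M a -> (forall g, g \in M -> ~ cone (M :\ g) a (a g)) ->
  A \subset M -> (forall i, i \in A -> (a i <= B)%MS) -> (#|A| <= 2)%N.
Proof.
move=> pM mM AM aB; rewrite leqNgt; apply/negP => /card_gt2P[x [y [z]]].
move=> [[xA yA zA] [xy yz zx]]; pose T := [set x; y; z].
have TA : T \subset A.
  by apply/subsetP => i; rewrite !inE -orbA => /or3P[]/eqP->.
have cT : #|T| = 3%N.
  by rewrite /T setUC cardsU1 cards2 !inE negb_or zx eq_sym yz xy.
have TM := subset_trans TA AM.
have [c [cT0 c_neq0]] : exists c : I -> R,
    \sum_(i in T) c i *: a i = 0 /\ exists2 i, i \in T & c i != 0.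
  have nfree : ~ row_free (family T a).
    move/eqP => r3; have : (\rank (family T a) <= \rank B)%N.
      apply: mxrankS; apply/row_subP => i; rewrite rowK aB //.
      by rewrite (subsetP TA) // enum_valP.
    by move=> /leq_trans/(_ (rank_leq_row B)); rewrite r3 cT.
  have [r [r0 rn]] : exists r : 'rV_#|T|, r *m family T a = 0 /\ r <> 0.
    apply: contrapT => /forallNP h; apply: nfree; apply: inj_row_free => r r0.
    by apply: contrapT => rn; apply: (h r).
  pose c i := \sum_(k < #|T|) (enum_val k == i)%:R * r 0 k.
  have cE k : c (enum_val k) = r 0 k.
    rewrite /c (bigD1 k) //= eqxx mul1r big1 ?addr0 // => l /negPf lk.
    by rewrite (inj_eq enum_val_inj) lk mul0r.
  exists c; split.
    rewrite big_enum_val -[RHS]r0 mulmx_sum_row; apply: eq_bigr => k _.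
    by rewrite cE rowK.
  have [k rk] : exists k, r 0 k != 0.
    apply: contrapT => /forallNP h; apply: rn; apply/rowP => k; rewrite mxE.
    by apply/eqP/negPn/negP; exact: h.
  by exists (enum_val k); rewrite ?enum_valP // cE.
have dep (e : I -> R) : \sum_(i in T) e i *: a i = 0 ->
    (exists2 i, i \in T & e i != 0) -> (#|[set i in T | (0 < e i)%R]| <= 1)%N -> False.
  move=> e0 [k kT ek] le1.
  have [g] : exists g, g \in [set i in T | (0 < e i)%R].
    apply/set0Pn/negP => /eqP/setP e_le0.
    have := pointed_sub TM pM (c := fun i => `|e i|).
    move=> /(_ (fun i => normr_ge0 _)) h; move: ek; rewrite -normr_eq0 h ?eqxx //.
    rewrite -[RHS]oppr0 -[in RHS]e0 -sumrN; apply: eq_bigr => i iT.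
    have := e_le0 i; rewrite !inE -/T; move: (iT); rewrite !inE => -> /= /negbT.
    by rewrite -leNgt => ei; rewrite ler0_norm // scaleNr.
  rewrite inE => /andP[gT eg].
  have neg i : i \in T -> i != g -> e i <= 0.
    move=> iT ig; rewrite leNgt; apply/negP => ei; move: le1; rewrite leqNgt => /negP[].
    apply/card_gt1P; exists i, g; split=> //; by rewrite inE ?iT ?gT.
  have gM : g \in M by exact: subsetP TM _ gT.
  apply: (mM g gM).
  exists (fun i => if (i \in T) && (i != g) then - e i / e g else 0) => [i|].
    case: ifP => // /andP[iT ig].
    by rewrite divr_ge0 ?oppr_ge0 ?neg // ltW.
  rewrite (big_setID T) /= [X in _ + X]big1 ?addr0; last first.
    by move=> i /setDP[_ /negPf->]; rewrite scale0r.
  have -> : (M :\ g) :&: T = T :\ g.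
    by rewrite setIDAC (setIidPr TM).
  rewrite (eq_bigr (fun i => - (e g)^-1 *: (e i *: a i))); last first.
    move=> i /setD1P[ig iT]; rewrite iT ig /= scalerA; congr (_ *: _).
    by rewrite mulrC mulrN mulNr.
  have /eqP := e0; rewrite (big_setD1 g) //= addrC addr_eq0 => /eqP egE.
  by rewrite -scaler_sumr egE scalerN scaleNr opprK scalerA mulVf ?scale1r // gt_eqF.
have [le1|gt1] := leqP #|[set i in T | (0 < c i)%R]| 1.
  exact: dep cT0 c_neq0 le1.
apply: (dep (fun i => - c i)).
- rewrite -[RHS]oppr0 -[in RHS]cT0 -sumrN.
  by apply: eq_bigr => i _; rewrite scaleNr.
- by case: c_neq0 => i iT ci; exists i; rewrite ?oppr_eq0.
have : (#|[set i in T | (0 < c i)%R]| + #|[set i in T | (0 < - c i)%R]| <= 3)%N.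
  rewrite -cT -cardsUI [X in (_ + X)%N](_ : _ = 0%N) ?addn0.
    by apply: subset_leq_card; apply/subsetP => i; rewrite !inE -andb_orr => /andP[].
  apply/eqP; rewrite cards_eq0; apply/eqP/setP => i; rewrite in_set0 inE !in_set.
  by apply/negP => /andP[/andP[_ ci] /andP[_]]; rewrite oppr_gt0 ltNge ltW.
by move=> le3; rewrite -(leq_add2l 2); apply: leq_trans le3; rewrite leq_add2r.
Qed.

End Pointed.

(** * Finite point sets seen from a simple vertex *)

Lemma sum_setU (T : finType) (W : nmodType) (A B : {set T}) (F : T -> W) :
  [disjoint A & B] ->
  \sum_(i in A :|: B) F i = \sum_(i in A) F i + \sum_(i in B) F i.
Proof.
by move=> AB; rewrite -bigU //; apply: eq_bigl => i; rewrite inE.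
Qed.

Section Corner.
Variables (R : realFieldType) (d : nat) (I : finType) (p : I -> 'rV[R]_d).
Variables (v : I) (w : 'I_d -> I).
Hypothesis p_vertex : forall i, pointed [set~ i] (fun j => p j - p i).
Hypothesis pv : p v = 0.
Hypothesis pw : forall k, p (w k) = delta_mx 0 k.
Hypothesis p_ge0 : forall i k, 0 <= p i 0 k.
Implicit Types (K L C : {set 'I_d}) (i j k l q u : 'I_d) (x y z g t : I).

Lemma pwE k l : p (w k) 0 l = (l == k)%:R.
Proof. by rewrite pw mxE eqxx. Qed.

Lemma vw k : (v == w k) = false.
Proof.
apply/negP => /eqP /(congr1 (fun x => p x 0 k)).
by rewrite pv pwE mxE eqxx => /eqP; rewrite eq_sym oner_eq0.
Qed.

Lemma w_inj : injective w.
Proof.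
move=> k l /(congr1 (fun x => p x 0 k)); rewrite !pwE eqxx.
by case: eqP => // _ /eqP; rewrite oner_eq0.
Qed.

(** A vertex is a convex combination of vertices only in the trivial way. *)
Lemma vertex_mem (S : {set I}) x (c : I -> R) : (forall y, 0 <= c y) ->
  \sum_(y in S) c y = 1 -> p x = \sum_(y in S) c y *: p y -> x \in S.
Proof.
move=> c0 c1 e; apply/negPn/negP => xS.
have Sx : S \subset [set~ x].
  by apply/subsetP => y yS; rewrite !inE; apply: contraTneq yS => ->.
have /(_ c c0) := pointed_sub Sx (@p_vertex x).
under eq_bigr do rewrite scalerBr.
rewrite sumrB -scaler_suml c1 scale1r e subrr => /(_ erefl) c00.
by move: c1; rewrite big1 => // /eqP; rewrite eq_sym oner_eq0.
Qed.

(** The simplex spanned by v and the axes in K. *)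
Definition corner K : {set I} := v |: (w @: K).

Lemma corner_mem K x : (forall k, k \notin K -> p x 0 k = 0) ->
  \sum_(k in K) p x 0 k <= 1 -> x \in corner K.
Proof.
move=> xK s1.
pose c y := (y == v)%:R * (1 - \sum_(k in K) p x 0 k)
            + \sum_(k in K) (y == w k)%:R * p x 0 k.
have cv : c v = 1 - \sum_(k in K) p x 0 k.
  by rewrite /c eqxx mul1r [X in _ + X]big1 ?addr0 // => k _; rewrite vw mul0r.
have cw k : k \in K -> c (w k) = p x 0 k.
  move=> kK; rewrite /c eq_sym vw mul0r add0r (bigD1 k) //= eqxx mul1r.
  rewrite big1 ?addr0 // => l /andP[_ /negPf lk].
  by rewrite (inj_eq w_inj) eq_sym lk mul0r.
have vK : v \notin w @: K by apply/imsetP => -[k _ /eqP]; rewrite vw.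
have sumK (V : nmodType) (F : I -> V) :
    \sum_(y in corner K) F y = F v + \sum_(k in K) F (w k).
  rewrite /corner big_setU1 //= big_imset //=; exact: in2W w_inj.
apply: (@vertex_mem _ _ c) => [y||].
- apply: addr_ge0; first by rewrite mulr_ge0 ?ler0n ?subr_ge0.
  by apply: sumr_ge0 => k _; rewrite mulr_ge0 ?ler0n.
- by rewrite sumK cv (eq_bigr _ cw) subrK.
- rewrite sumK pv scaler0 add0r; apply/rowP => k; rewrite summxE.
  under eq_bigr => l lK do rewrite mxE cw // pwE.
  have [kK|kK] := boolP (k \in K).
    rewrite (bigD1 k) //= eqxx mulr1 big1 ?addr0 // => l /andP[_ /negPf lk].
    by rewrite eq_sym lk mulr0.
  rewrite xK // big1 // => l lK; case: eqP => [kl|]; last by rewrite mulr0.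
  by move: kK; rewrite kl lK.
Qed.

(** The vertices of the face spanned by v and the axes in K; no coordinate is
negative, so setting coordinates to zero does define a face. *)
Definition fverts K : {set I} :=
  [set x | [forall k, (k \notin K) ==> (p x 0 k == 0)]].

Lemma in_fverts K x : reflect (forall k, k \notin K -> p x 0 k = 0) (x \in fverts K).
Proof.
rewrite inE; apply: (iffP forallP) => h k.
  by move=> kK; have := h k; rewrite kK => /eqP.
by apply/implyP => /h ->.
Qed.

Lemma fvertsE K x : (x \in fverts K) = [forall k, (k \notin K) ==> (p x 0 k == 0)].
Proof. by rewrite inE. Qed.

Lemma fverts_sub K L : K \subset L -> fverts K \subset fverts L.
Proof.
move=> KL; apply/subsetP => x /in_fverts xK; apply/in_fverts => k kL; apply: xK.
by apply: contraNN kL; apply: (subsetP KL).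
Qed.

Lemma v_fverts K : v \in fverts K.
Proof. by apply/in_fverts => k _; rewrite pv mxE. Qed.

Lemma w_fverts K k : (w k \in fverts K) = (k \in K).
Proof.
apply/in_fverts/idP => [h|kK l lK].
  by apply: contraT => /h; rewrite pwE eqxx => /eqP; rewrite oner_eq0.
by rewrite pwE; case: eqP lK => // ->; rewrite kK.
Qed.

Lemma corner_fverts K : corner K \subset fverts K.
Proof.
apply/subsetP => x; rewrite in_setU1 => /predU1P[->|/imsetP[k kK ->]].
  exact: v_fverts.
by rewrite w_fverts.
Qed.

Lemma fverts_D1 K k x : k \in K ->
  (x \in fverts (K :\ k)) = (x \in fverts K) && (p x 0 k == 0).
Proof.
move=> kK; apply/in_fverts/andP => [h|[/in_fverts h /eqP xk] l].
  split; last by rewrite h // !inE eqxx.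
  by apply/in_fverts => l lK; apply: h; rewrite !inE negb_and lK orbT.
by rewrite !inE negb_and negbK => /orP[/eqP->|/h].
Qed.

(** If the coordinate exceeds 1, it is w k that lies strictly between v and x. *)
Lemma axis_mem x k : (forall l, l != k -> p x 0 l = 0) -> x = v \/ x = w k.
Proof.
move=> xk; have [s1|s1] := leP (p x 0 k) 1.
  have : x \in corner [set k].
    apply: corner_mem => [l|]; first by rewrite inE; apply: xk.
    by rewrite big_set1.
  by rewrite /corner imset_set1 !inE => /orP[]/eqP; [left|right].
have px0 : 0 < p x 0 k by apply: lt_trans s1.
have xv : x != v by apply: contraTneq px0 => ->; rewrite pv mxE ltxx.
pose c y := if y == x then (p x 0 k)^-1 else 1 - (p x 0 k)^-1.
have : w k \in [set x; v].
  apply: (@vertex_mem _ _ c) => [y||].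
  - by rewrite /c; case: ifP; rewrite ?invr_ge0 ?subr_ge0 ?(ltW px0) // invf_le1 // ltW.
  - by rewrite big_setU1 ?inE //= big_set1 /c eqxx eq_sym (negPf xv) addrC subrK.
  - rewrite big_setU1 ?inE //= big_set1 pv scaler0 addr0 /c eqxx.
    apply/rowP => l; rewrite pwE mxE; case: eqP => [->|/eqP lk].
      by rewrite mulVf // gt_eqF.
    by rewrite (xk l) // mulr0.
by rewrite !inE => /orP[/eqP->|]; [right|rewrite eq_sym vw].
Qed.

(** Simplicity of x in the face spanned by the axes in K, expressed through the
generators of its vertex cone: since that face has dimension #|K|, fewer
generators are impossible. *)
Definition fsimple K x : Prop := exists M : {set I},
  [/\ M \subset fverts K, (#|M| <= #|K|)%N &
    forall y, y \in fverts K -> cone M (fun g => p g - p x) (p y - p x)].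

Definition fnonsimple K : {set I} := [set x in fverts K | ~~ `[< fsimple K x >]].

Lemma in_fnonsimple K x : x \in fnonsimple K <-> x \in fverts K /\ ~ fsimple K x.
Proof.
rewrite inE; split=> [/andP[? /asboolPn]|[-> h]] //=; exact/asboolPn.
Qed.

Lemma fsimple_v K : fsimple K v.
Proof.
exists (w @: K); split.
- exact: subset_trans (subsetUr _ _) (corner_fverts K).
- by rewrite card_imset //; exact: w_inj.
move=> y /in_fverts yK; exists (fun g => \sum_(k in K) (g == w k)%:R * p y 0 k).
  by move=> g; apply: sumr_ge0 => k _; rewrite mulr_ge0 ?ler0n.
rewrite pv subr0 big_imset /=; last exact: in2W w_inj.
apply/rowP => l; rewrite summxE.
transitivity (\sum_(k in K) p y 0 k * (l == k)%:R); last first.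
  apply: eq_bigr => k kK; rewrite subr0 mxE pwE; congr (_ * _).
  rewrite (bigD1 k) //= eqxx mul1r big1 ?addr0 // => l' /andP[_ /negPf l'k].
  by rewrite (inj_eq w_inj) eq_sym l'k mul0r.
have [lK|lK] := boolP (l \in K).
  rewrite (bigD1 l) //= eqxx mulr1 big1 ?addr0 // => k /andP[_ /negPf kl].
  by rewrite eq_sym kl mulr0.
rewrite yK // big1 // => k kK; case: eqP lK => [->|]; first by rewrite kK.
by rewrite mulr0.
Qed.

Lemma coord_eq (M : {set I}) x y (c : I -> R) k : p x 0 k = 0 ->
  p y - p x = \sum_(g in M) c g *: (p g - p x) ->
  p y 0 k = \sum_(g in M) c g * p g 0 k.
Proof.
move=> xk /rowP/(_ k); rewrite summxE !mxE xk subr0 => ->.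
by apply: eq_bigr => g _; rewrite !mxE xk subr0.
Qed.

Lemma coord_eq0 (M : {set I}) x y (c : I -> R) k : (forall g, 0 <= c g) ->
  p x 0 k = 0 -> p y 0 k = 0 ->
  p y - p x = \sum_(g in M) c g *: (p g - p x) ->
  forall g, g \in M -> c g != 0 -> p g 0 k = 0.
Proof.
move=> c0 xk yk /(coord_eq xk); rewrite yk => /esym/psumr_eq0P h g gM cg.
have /eqP : c g * p g 0 k = 0 by apply: h => // z _; rewrite mulr_ge0.
by rewrite mulf_eq0 (negPf cg) => /eqP.
Qed.

Lemma coord_neq0 (M : {set I}) x y (c : I -> R) k :
  p x 0 k = 0 -> p y 0 k != 0 ->
  p y - p x = \sum_(g in M) c g *: (p g - p x) ->
  exists g, [/\ g \in M, c g != 0 & p g 0 k != 0].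
Proof.
move=> xk yk /(coord_eq xk) e; apply: contrapT => /forallNP h.
move: yk; rewrite e big1 ?eqxx // => g gM; apply/eqP.
rewrite mulf_eq0; apply/negPn; rewrite negb_or; apply/negP => /andP[cg gk].
by apply: (h g).
Qed.

(** A coordinate which vanishes at x and y is nonnegative on all generators, so it
vanishes on those which contribute to p y - p x. *)
Lemma face_cone (M : {set I}) L K x y : L \subset K -> M \subset fverts K ->
  x \in fverts L -> y \in fverts L ->
  cone M (fun g => p g - p x) (p y - p x) ->
  cone (M :&: fverts L) (fun g => p g - p x) (p y - p x).
Proof.
move=> LK MK /in_fverts xL /in_fverts yL [c c0 e]; exists c => //.
rewrite {1}e (big_setID (fverts L)) /= [X in _ + X]big1 ?addr0 // => g /setDP[gM gL].
have [->|cg] := eqVneq (c g) 0; first by rewrite scale0r.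
case/negP: gL; apply/in_fverts => k kL.
by apply: coord_eq0 e g gM cg => //; [apply: xL|apply: yL].
Qed.

(** In passing to the facet with x_k = 0, a generator with positive coordinate k is
lost; there is one, as w k is a point of the cone. *)
Lemma fsimple_D1 K k x : k \in K ->
  fsimple K x -> x \in fverts (K :\ k) -> fsimple (K :\ k) x.
Proof.
move=> kK [M [MK Mc Mg]] xK; have [xV /eqP xk] : x \in fverts K /\ p x 0 k == 0.
  by apply/andP; rewrite -fverts_D1.
exists (M :&: fverts (K :\ k)); split; first exact: subsetIr.
  have [c c0 e] := Mg (w k) ltac:(by rewrite w_fverts).
  have [|g [gM _ gk]] := coord_neq0 xk _ e; first by rewrite pwE eqxx oner_eq0.
  rewrite -ltnS (leq_trans _ (leq_trans Mc _)) //; last by rewrite (cardsD1 k) kK.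
  apply: proper_card; apply/properP; split; first exact: subsetIl.
  by exists g => //; rewrite inE fverts_D1 // (negPf gk) !andbF.
move=> y yK; apply: (face_cone (subsetDl _ _) MK xK yK); apply: Mg.
by move: yK; rewrite fverts_D1 // => /andP[].
Qed.

Lemma fnonsimple_D1 K k : k \in K -> fnonsimple (K :\ k) \subset fnonsimple K.
Proof.
move=> kK; apply/subsetP => x /in_fnonsimple[xK xs]; apply/in_fnonsimple; split.
  by apply: (subsetP (fverts_sub (subsetDl K [set k]))).
by move=> sK; apply: xs; apply: fsimple_D1.
Qed.

Lemma card_gen (M : {set I}) L x : x \in fverts L ->
  (forall y, y \in fverts L -> cone M (fun g => p g - p x) (p y - p x)) ->
  (#|L| <= #|M|)%N.
Proof.
move=> xL Mg; apply: (@leq_span _ _ _ _ (family M (fun g => p g - p x))) => l lL.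
have -> : (delta_mx 0 l : 'rV[R]_d) = (p (w l) - p x) - (p v - p x).
  by rewrite pv pw opprB addrA subrK subr0.
apply: addmx_sub; rewrite ?eqmx_opp; apply: cone_family; apply: Mg.
  by rewrite w_fverts.
exact: v_fverts.
Qed.


Lemma card_corner K : #|corner K| = #|K|.+1.
Proof.
rewrite cardsU1 card_imset; last exact: w_inj.
by case: imsetP => // -[k _ /eqP]; rewrite vw.
Qed.

Lemma corner_card K : (#|fverts K| <= #|K|.+1)%N -> fverts K = corner K.
Proof.
move=> h; apply/esym/eqP.
by rewrite eqEcard corner_fverts card_corner.
Qed.

(** Otherwise every vertex in the plane of the axes u and j is v, w u or w j, which
forces the generators at w u to be v and the w k with k in K; they satisfy the
inequality that the coordinates in K add up to at most 1, which is an equality at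
w u, so it holds on the whole face and makes the face a simplex. *)
Lemma plane_vertex K u : u \in K -> fsimple K (w u) ->
  ~~ (fverts K \subset corner K) ->
  exists j z, [/\ j \in K, j != u, z \in fverts [set u; j], 0 < p z 0 u & 0 < p z 0 j].
Proof.
move=> uK [M [MK Mc Mg]] /negP; apply: contra_notP => /forallNP h.
have wu0 l : l != u -> p (w u) 0 l = 0 by move=> /negPf lu; rewrite pwE lu.
have plane z j : j \in K -> j != u -> z \in fverts [set u; j] -> p z 0 j != 0 -> z = w j.
  move=> jK ju zV zj; have zj0 : 0 < p z 0 j by rewrite lt_neqAle eq_sym zj p_ge0.
  have zu : p z 0 u = 0.
    apply/eqP/negPn/negP => zu; case: (h j); exists z; split=> //.
    by rewrite lt_neqAle eq_sym zu p_ge0.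
  have [l lj|zv|//] := @axis_mem z j; last by move: zj; rewrite zv pv mxE eqxx.
  have [->//|lu] := eqVneq l u.
  by apply: (in_fverts _ _ zV); rewrite !inE negb_or lu.
have wM j : j \in K -> j != u -> w j \in M.
  move=> jK ju; have [|c c0 e] := Mg (w j); first by rewrite w_fverts.
  have [||g [gM cg gj]] := coord_neq0 (k := j) _ _ e; first exact: wu0.
    by rewrite pwE eqxx oner_eq0.
  rewrite -(plane g j) //; apply/in_fverts => l; rewrite !inE negb_or => /andP[lu lj].
  by apply: (coord_eq0 c0 (wu0 l lu) _ e gM cg); rewrite pwE (negPf lj).
have vM : v \in M.
  have [|c c0 e] := Mg v; first exact: v_fverts.
  have : exists g, [/\ g \in M, c g != 0 & p g 0 u != 1].
    apply: contrapT => /forallNP h1; have /rowP/(_ u)/eqP := e.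
    rewrite summxE !mxE pv mxE pwE eqxx sub0r big1 ?oppr_eq0 ?oner_eq0 // => g gM.
    rewrite !mxE pwE eqxx; apply/eqP; rewrite mulf_eq0 subr_eq0.
    apply/negPn; rewrite negb_or; apply/negP => /andP[cg gu]; exact: (h1 g).
  case=> g [gM cg gu].
  have [l lu|<-//|gw] := @axis_mem g u; last by move: gu; rewrite gw pwE !eqxx.
  by apply: (coord_eq0 c0 (wu0 l lu) _ e gM cg); rewrite pv mxE.
have MC : corner K :\ w u = M.
  apply/eqP; rewrite eqEcard; apply/andP; split.
    apply/subsetP => g /setD1P[gu]; rewrite in_setU1 => /predU1P[->//|].
    case/imsetP => k kK gk; rewrite gk wM //.
    by apply: contraNneq gu => <-; rewrite gk.
  have wuC : w u \in corner K by rewrite in_setU1 imset_f ?orbT.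
  by have := card_corner K; rewrite (cardsD1 (w u)) wuC add1n => /succn_inj->.
apply/subsetP => y yK; apply: corner_mem; first exact/in_fverts.
have [c c0 e] := Mg y yK.
have sum1 k : k \in K -> \sum_(l in K) p (w k) 0 l = 1.
  move=> kK; rewrite (bigD1 k) //= pwE eqxx big1 ?addr0 // => l /andP[_ /negPf lk].
  by rewrite pwE lk.
rewrite -subr_le0 -{1}(sum1 u uK) -sumrB.
have -> : \sum_(l in K) (p y 0 l - p (w u) 0 l) =
    \sum_(g in M) c g * (\sum_(l in K) p g 0 l - 1).
  under eq_bigr => l _.
    have /rowP/(_ l) := e; rewrite summxE !mxE => ->; over.
  rewrite exchange_big /=; apply: eq_bigr => g _.
  by rewrite -{1}(sum1 u uK) -sumrB mulr_sumr; apply: eq_bigr => l _; rewrite !mxE.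
apply: sumr_le0 => g; rewrite -MC => /setD1P[_ gC].
apply: mulr_ge0_le0 => //; move: gC; rewrite in_setU1 => /predU1P[->|].
  by rewrite big1 ?sub0r ?oppr_le0 ?ler01 // => l _; rewrite pv mxE.
by case/imsetP => k kK ->; rewrite sum1 ?subrr.
Qed.

(** All edges from an apex lead to the base, and each vertex of the base is joined
to the apex by an edge; at a simple apex the base thus has only #|K| vertices. *)
Lemma simple_apex K q : (forall y, y \in fverts K -> y != w q -> p y 0 q = 0) ->
  fsimple K (w q) -> fverts K = corner K.
Proof.
move=> hq [M [MK Mc Mg]]; apply: corner_card.
suff sub : fverts K :\ w q \subset M.
  rewrite (cardsD1 (w q)) -add1n leq_add ?leq_b1 //.
  exact: leq_trans (subset_leq_card sub) Mc.
apply/subsetP => y /setD1P[yq yK]; have [c c0 e] := Mg y yK.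
have {}e : p y - p (w q) = \sum_(g in M :\ w q) c g *: (p g - p (w q)).
  rewrite {}e; have [qM|qM] := boolP (w q \in M).
    by rewrite (big_setD1 _ qM) /= subrr scaler0 add0r.
  by rewrite (setDidPl _) // disjoint_sym disjoints1.
suff : y \in M :\ w q by move/setD1P => [].
have c1 : \sum_(g in M :\ w q) c g = 1.
  have /rowP/(_ q) := e; rewrite summxE !mxE hq // pwE eqxx sub0r.
  rewrite (eq_bigr (fun g => - c g)) => [|g /setD1P[gq gM]].
    by rewrite sumrN => /oppr_inj.
  by rewrite !mxE pwE eqxx hq ?(subsetP MK) // sub0r mulrN1.
apply: (vertex_mem c0 c1).
move: e; under eq_bigr do rewrite scalerBr.
by rewrite sumrB -scaler_suml c1 scale1r => /addIr.
Qed.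

(** A minimal set of generators at x has at most two members in the plane, and the
others are among the vertices outside the plane. *)
Lemma plane_fsimple K u j x : u \in K -> j \in K -> x \in fverts [set u; j] ->
  (#|fverts K :\: fverts [set u; j]|.+2 <= #|K|)%N -> fsimple K x.
Proof.
move=> uK jK xP le; pose a g := p g - p x.
have [M [MS Mgen Mmin]] := minimal_generators (fverts K :\ x) a.
have MK : M \subset fverts K := subset_trans MS (subsetDl _ _).
exists M; split=> //; last first.
  move=> y yK; have [->|yx] := eqVneq y x; first by rewrite subrr; apply: cone0.
  by apply: Mgen; rewrite !inE yx in yK *.
have M2 : (#|M :&: fverts [set u; j]| <= 2)%N.
  have pM : pointed M a.
    apply: pointed_sub (@p_vertex x); apply: subset_trans MS _.
    by apply/subsetP => y; rewrite !inE => /andP[].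
  pose B : 'M[R]_(1 + 1, d) := col_mx (delta_mx 0 u) (delta_mx 0 j).
  have inB y : y \in fverts [set u; j] -> (p y <= B)%MS.
    move=> /in_fverts yP; rewrite (row_sum_delta (p y)); apply: summx_sub => k _.
    have [->|] := eqVneq k u.
      by apply/scalemx_sub; rewrite -addsmxE addsmxSl.
    have [->|kj ku] := eqVneq k j.
      by move=> _; apply/scalemx_sub; rewrite -addsmxE addsmxSr.
    by rewrite yP ?scale0r ?sub0mx // !inE negb_or ku.
  apply: (@minimal_plane _ _ _ M _ a B pM Mmin); first exact: subsetIl.
  by move=> g /setIP[_ gP]; rewrite addmx_sub ?inB // eqmx_opp inB.
rewrite (leq_trans _ le) // -(cardsID (fverts [set u; j]) M) -add2n leq_add //.
by apply: subset_leq_card; apply: setSD.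
Qed.

(** The hypothesis on C makes the w k with k in C the only vertices outside the face
L at which some coordinate in C vanishes. As C has another element than k, the
generator from which w k gets its coordinate k is such a vertex, so it is w k
itself: all these w k are among the generators M at x. The generators in L number at least #|L|, hence M, which has at
most #|K| members, has no others; and w k alone accounts for the coordinate k
of t. *)
Lemma block_tangent K C t x (L := K :\: C) : C \subset K -> (1 < #|C|)%N ->
  (forall y k, y \in fverts K -> k \in C -> p y 0 k = 0 ->
     y \in fverts L \/ exists2 l, l \in C & y = w l) ->
  t \in fverts K -> x \in fverts L -> fsimple K x ->
  exists2 c : I -> R, (forall g, 0 <= c g) &
    p t - p x = \sum_(k in C) p t 0 k *: (p (w k) - p x)
                + \sum_(g in fverts L) c g *: (p g - p x).
Proof.
move=> CK C2 hC tK xL [M [MK Mc Mg]].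
have Lx y k : y \in fverts L -> k \in C -> p y 0 k = 0.
  by move=> /in_fverts yL kC; apply: yL; rewrite inE kC.
have wLC k : k \in C -> (w k \in fverts L) = false by move=> kC; rewrite w_fverts !inE kC.
have wM k : k \in C -> w k \in M.
  move=> kC; have [|c c0 e] := Mg (w k); first by rewrite w_fverts (subsetP CK).
  have [||g [gM cg gk]] := coord_neq0 (k := k) _ _ e; first exact: Lx.
    by rewrite pwE eqxx oner_eq0.
  have [k' k'C kk'] : exists2 k', k' \in C & k' != k.
    move: C2; rewrite (cardsD1 k) kC add1n ltnS => /card_gt0P[k' /setD1P[? ?]].
    by exists k'.
  have gk' : p g 0 k' = 0.
    apply: (coord_eq0 c0 (Lx _ _ xL k'C) _ e gM cg).
    by rewrite pwE (negPf kk').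
  have [gL|[l lC gl]] := hC g k' (subsetP MK g gM) k'C gk'.
    by move: gk; rewrite Lx ?eqxx.
  by move: gk; rewrite gl pwE; case: (k =P l) => [->|_]; rewrite ?eqxx -?gl.
have disj : [disjoint w @: C & M :&: fverts L].
  rewrite -setI_eq0; apply/eqP/setP => g; rewrite inE in_set0.
  by apply/negP => /andP[/imsetP[k kC ->]]; rewrite inE wLC // andbF.
have ME : w @: C :|: (M :&: fverts L) = M.
  apply/eqP; rewrite eqEcard; apply/andP; split.
    rewrite subUset subsetIl andbT; apply/subsetP => g /imsetP[k kC ->]; exact: wM.
  rewrite cardsU (eqP (_ : w @: C :&: (M :&: fverts L) == set0)) ?setI_eq0 // cards0 subn0.
  rewrite card_imset; last exact: w_inj.
  rewrite (leq_trans Mc) // -(cardsID C K) (setIidPr CK) leq_add2l.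
  apply: (card_gen xL) => y yL; apply: (face_cone (subsetDl _ _) MK xL yL).
  by apply: Mg; apply: (subsetP (fverts_sub (subsetDl K C))).
have [c c0 e] := Mg t tK.
exists (fun g => if g \in M then c g else 0) => [g|]; first by case: ifP.
rewrite {1}e -{1}ME sum_setU //=; congr (_ + _).
  rewrite big_imset /=; last exact: in2W w_inj.
  apply: eq_bigr => k kC; congr (_ *: _).
  rewrite (coord_eq (Lx _ _ xL kC) e) (bigD1 (w k)) ?wM //= pwE eqxx mulr1.
  rewrite big1 ?addr0 // => g /andP[gM gk]; move: (gM); rewrite -ME in_setU.
  case/orP => [/imsetP[l _ gl]|/setIP[_ gL]]; last by rewrite Lx ?mulr0.
  move: gk; rewrite gl pwE (inj_eq w_inj) eq_sym => /negPf->; exact: mulr0.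
rewrite [RHS](big_setID M) /= setIC [X in _ + X]big1 ?addr0.
  by apply: eq_bigr => g /setIP[_ ->].
by move=> g /setDP[_ /negPf->]; rewrite scale0r.
Qed.

Definition hom y : 'rV[R]_(1 + d) := row_mx 1%:M (p y).

Lemma homB x y : hom y - hom x = (p y - p x) *m row_mx 0 1%:M.
Proof.
by rewrite /hom opp_row_mx add_row_mx subrr mul_mx_row mulmx0 mulmx1.
Qed.

Lemma hom_span L m (B : 'M[R]_(m, 1 + d)) :
  (forall y, y \in fverts L -> (hom y <= B)%MS) -> (#|L| < m)%N.
Proof.
move=> hB; pose L' := lshift d ord0 |: (@rshift 1 d) @: L.
have -> : #|L|.+1 = #|L'|.
  rewrite cardsU1 card_imset; last exact: rshift_inj.
  by case: imsetP => // -[k _ /eqP]; rewrite eq_lrshift.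
apply: (leq_span (B := B)) => l.
have hv : (delta_mx 0 (lshift d ord0) : 'rV[R]_(1 + d)) = hom v.
  rewrite /hom pv; apply/rowP => k; rewrite !mxE; case: splitP => k' kk'.
    by rewrite !mxE -!val_eqE /= kk' ord1.
  by rewrite mxE -!val_eqE /= kk'.
rewrite in_setU1 => /predU1P[->|/imsetP[k kL ->]].
  by rewrite hv hB // v_fverts.
have -> : (delta_mx 0 (rshift 1 k) : 'rV[R]_(1 + d)) = hom (w k) - hom v.
  rewrite homB pv subr0 pw -rowE; apply/rowP => i; rewrite !mxE.
  case: splitP => i' ii'; rewrite -!val_eqE /= ii' mxE -?val_eqE /=.
    by rewrite ord1.
  by rewrite eqn_add2l eq_sym.
by rewrite addmx_sub ?hB ?w_fverts // eqmx_opp hB // v_fverts.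
Qed.

(** T is t without its components along the w k, in homogeneous coordinates. If T is
in the cone over the face L, then t is a convex combination of vertices of L and
of the w k. Otherwise a facet of that cone separates T from it. The facet has at
least #|L| vertices and fewer than #|L| of them are nonsimple, and at a simple one
[block_tangent] shows that T satisfies the inequality of the facet. *)
Lemma no_block K C t (L := K :\: C) : C \subset K -> (1 < #|C|)%N ->
  (forall y k, y \in fverts K -> k \in C -> p y 0 k = 0 ->
     y \in fverts L \/ exists2 l, l \in C & y = w l) ->
  (#|fnonsimple K| < #|K|)%N -> (forall k, k \in C -> w k \in fnonsimple K) ->
  t \in fverts K -> t \in fverts L \/ t \in w @: C.
Proof.
move=> CK C2 hC NK wN tK; apply/orP; rewrite -in_setU setUC.
pose T := hom t - \sum_(k in C) p t 0 k *: hom (w k).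
have Lx y k : y \in fverts L -> k \in C -> p y 0 k = 0.
  by move=> /in_fverts yL kC; apply: yL; rewrite inE kC.
have disj : [disjoint w @: C & fverts L].
  rewrite -setI_eq0; apply/eqP/setP => g; rewrite inE in_set0.
  by apply/negP => /andP[/imsetP[k kC ->]]; rewrite w_fverts inE kC.
have [[c c0 e]|nT] := pselect (cone (fverts L) hom T).
  (* the second summand is p t 0 k at g = w k and vanishes on the face L *)
  pose e' g := (g \in fverts L)%:R * c g + \sum_(k in C) p g 0 k * p t 0 k.
  have e'L g : g \in fverts L -> e' g = c g.
    by move=> gL; rewrite /e' gL mul1r big1 ?addr0 // => k kC; rewrite Lx ?mul0r.
  have e'C k : k \in C -> e' (w k) = p t 0 k.
    move=> kC; rewrite /e' w_fverts inE kC mul0r add0r (bigD1 k) //= pwE eqxx mul1r.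
    by rewrite big1 ?addr0 // => l /andP[_ /negPf lk]; rewrite pwE lk mul0r.
  have ht : hom t = \sum_(g in w @: C :|: fverts L) e' g *: hom g.
    rewrite sum_setU // [X in _ + X](eq_bigr (fun g => c g *: hom g)) => [|g /e'L->//].
    rewrite -e addrC -[LHS](subrK (\sum_(k in C) p t 0 k *: hom (w k))).
    congr (_ + _); rewrite big_imset /=; last exact: in2W w_inj.
    by apply: eq_bigr => k /e'C->.
  apply: (@vertex_mem _ _ e') => [y||].
  - apply: addr_ge0; first by rewrite mulr_ge0 ?ler0n.
    by apply: sumr_ge0 => k _; rewrite mulr_ge0.
  - have /(congr1 lsubmx)/rowP/(_ ord0) := ht; rewrite row_mxKl linear_sum summxE.
    rewrite mxE eqxx mulr1n => ->; apply: eq_bigr => g _.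
    by rewrite linearZ /= row_mxKl !mxE eqxx mulr1.
  have /(congr1 rsubmx) := ht; rewrite row_mxKr linear_sum => ->.
  by apply: eq_bigr => g _; rewrite linearZ /= row_mxKr.
have [phi [phi0 phiT phiZ]] := facet_functional nT; exfalso.
set Z := [set j in fverts L | _] in phiZ.
have LZ : (#|L| <= #|Z|)%N by rewrite -ltnS -add1n; apply: hom_span phiZ.
have [x xZ xN] : exists2 x, x \in Z & x \notin fnonsimple K.
  apply: contrapT => h; have ZN : Z \subset fnonsimple K :\: w @: C.
    apply/subsetP => x xZ; rewrite inE; apply/andP; split.
      apply/negP => xC; have := disjointFr disj xC.
      by move: xZ; rewrite inE => /andP[->].
    by apply: contrapT => /negP xN; apply: h; exists x.
  have := subset_leq_card ZN.
  have wCN : w @: C \subset fnonsimple K by apply/subsetP => x /imsetP[k kC ->]; apply: wN.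
  have := cardsID (w @: C) (fnonsimple K); rewrite (setIidPr wCN) card_imset; last exact: w_inj.
  have := cardsID C K; rewrite (setIidPr CK) -/L => eK eN le.
  by move: NK; rewrite -eK -eN ltn_add2l ltnNge (leq_trans LZ le).
move: xZ; rewrite inE => /andP[xL /eqP phix].
have xs : fsimple K x.
  apply: contrapT => xs; case/negP: xN; apply/in_fnonsimple; split=> //.
  exact: subsetP (fverts_sub (subsetDl K C)) _ xL.
have [c c0 e] := block_tangent CK C2 hC tK xL xs.
have : hom t - hom x = \sum_(k in C) p t 0 k *: (hom (w k) - hom x)
    + \sum_(g in fverts L) c g *: (hom g - hom x).
  rewrite homB e mulmxDl !mulmx_suml; congr (_ + _); apply: eq_bigr => g _.
    by rewrite homB -scalemxAl.
  by rewrite homB -scalemxAl.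
move=> /(congr1 (ev phi)); rewrite linearB linearD /= !ev_sum phix subr0.
have evB y : ev phi (hom y - hom x) = ev phi (hom y) by rewrite linearB /= phix subr0.
under eq_bigr do rewrite evB.
under [X in _ = _ + X]eq_bigr do rewrite evB.
move=> et; move: phiT; rewrite /T linearB /= ev_sum et addrC addKr.
by rewrite ltNge sumr_ge0 // => g gL; rewrite mulr_ge0 ?phi0.
Qed.

(** Here good i is the bound on nonsimple vertices that the induction hypothesis asks
of the facet x_i = 0; the bound on its vertices always holds, since without an
apex in K the facet misses a vertex besides w i. A facet which is not good
contains all nonsimple vertices. *)
Lemma apex_exists K : (#|fverts K| < 2 * #|K|)%N -> (#|fnonsimple K| < #|K|)%N ->
  exists2 k, k \in K & forall x, x \in fverts K -> x != w k -> p x 0 k = 0.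
Proof.
move: {2}#|K| (leqnn #|K|) => n; elim: n K => [|n IH] K Kn VK NK.
  by move: NK; rewrite ltnNge (leq_trans Kn).
apply: contrapT => no_apex.
have wit k : k \in K -> exists x, [/\ x \in fverts K, x != w k & p x 0 k != 0].
  move=> kK; apply: contrapT => /forallNP h; apply: no_apex; exists k => // x xK xk.
  by apply: contrapT => /eqP xk0; apply: (h x).
have ncorner : ~~ (fverts K \subset corner K).
  apply/negP => sub; have /card_gt0P[k kK] : (0 < #|K|)%N by apply: leq_trans NK.
  have [x [xK xk xk0]] := wit k kK; move: (subsetP sub x xK) xk xk0.
  rewrite in_setU1 => /predU1P[->|/imsetP[l _ ->]]; first by rewrite pv mxE eqxx.
  by rewrite pwE (inj_eq w_inj) eq_sym => /negPf->; rewrite eqxx.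
have [u uK us] : exists2 u, u \in K & fsimple K (w u).
  apply: contrapT => h; move: NK; rewrite ltnNge -(card_imset K w_inj).
  case/negP; apply: subset_leq_card; apply/subsetP => x /imsetP[k kK ->].
  by apply/in_fnonsimple; rewrite w_fverts; split=> // ks; apply: h; exists k.
have [j [z [jK ju zP zu zj]]] := plane_vertex uK us ncorner.
have PK : [set u; j] \subset K by apply/subsetP => k; rewrite !inE => /orP[]/eqP->.
have zw l : z != w l.
  apply/eqP => zl; move: zu zj; rewrite zl !pwE.
  by case: (u =P l) => [<- _|_]; rewrite ?(negPf ju) ltxx.
have zv : z != v by apply: contraTneq zu => ->; rewrite pv mxE ltxx.
pose good i := (#|fnonsimple (K :\ i)| < #|K :\ i|)%N.
have bad i : i \in K -> ~~ good i -> fnonsimple (K :\ i) = fnonsimple K.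
  move=> iK; rewrite /good -leqNgt => h; apply/eqP; rewrite eqEcard fnonsimple_D1 //=.
  by apply: leq_trans h; move: NK; rewrite (cardsD1 i K) iK add1n ltnS.
have step i : i \in K -> i != u -> i != j -> good i -> exists2 q,
    [/\ q \in K, q != i, q != u & q != j] &
    [/\ good q, w q \in fnonsimple K &
      forall y, y \in fverts K -> p y 0 i = 0 -> y != w q -> p y 0 q = 0].
  move=> iK iu ij gi; have cK := cardsD1 i K; rewrite iK add1n in cK.
  have [x [xK xi xi0]] := wit i iK.
  have zi : z \in fverts (K :\ i).
    apply: (subsetP (fverts_sub _)) zP; apply/subsetP => k; rewrite !inE.
    by case/orP => /eqP->; rewrite eq_sym ?iu ?ij.
  have [||q] := IH (K :\ i) _ _ gi; first by move: Kn; rewrite cK.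
    have /subset_leq_card le : fverts (K :\ i) \subset fverts K :\ w i :\ x.
      apply/subsetP => y; rewrite fverts_D1 // => /andP[yK /eqP yi]; rewrite !inE.
      rewrite -fvertsE yK andbT; apply/andP; split.
        by apply: contra_neq xi0 => <-.
      by apply/eqP => yw; move: yi; rewrite yw pwE eqxx => /eqP; rewrite oner_eq0.
    have := cardsD1 (w i) (fverts K); have := cardsD1 x (fverts K :\ w i).
    rewrite w_fverts iK in_setD1 xi xK !add1n => e1 e2; apply: leq_ltn_trans le _.
    by move: VK; rewrite e2 e1 cK mulnS add2n !ltnS.
  case/setD1P => qi qK apexq.
  have zq : p z 0 q = 0 by apply: apexq; rewrite ?zw.
  have qu : q != u by apply: contraTneq zu => <-; rewrite zq ltxx.
  have qj : q != j by apply: contraTneq zj => <-; rewrite zq ltxx.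
  have wqN : w q \in fnonsimple K.
    apply/in_fnonsimple; split; first by rewrite w_fverts.
    move=> sq; have wqi : w q \in fverts (K :\ i) by rewrite w_fverts !inE qi.
    have := simple_apex apexq (fsimple_D1 iK sq wqi) => VE.
    move: zi; rewrite VE in_setU1 (negPf zv) => /imsetP[l _ /eqP].
    by rewrite (negPf (zw l)).
  exists q => //; split=> //.
    apply/negPn/negP => /(bad q qK) NE; move: wqN; rewrite -NE => /in_fnonsimple[].
    by rewrite w_fverts !inE eqxx.
  by move=> y yK yi yq; apply: apexq; rewrite // fverts_D1 // yK yi eqxx.
have [[i0 [i0K i0u i0j gi0]]|none] := pselect
    (exists i, [/\ i \in K, i != u, i != j & good i]).
  (* Leaving the vertices w k with k in E out of Z i makes Z i a subset of Z q, for q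
     the apex axis of the facet x_i = 0; so from an i with Z i of maximal size on,
     Z is constant along the axes obtained by repetition. *)
  pose E := [set i in K | [&& i != u, i != j, good i & w i \in fnonsimple K]].
  pose Z i := [set y in fverts K | (p y 0 i == 0) && (y \notin w @: E)].
  have EP i : i \in E -> [/\ i \in K, i != u, i != j, good i & w i \in fnonsimple K].
    by rewrite inE => /andP[-> /and4P[]].
  have stepE i : i \in K -> i != u -> i != j -> good i ->
      exists q, [/\ q \in E, q != i & Z i \subset Z q].
    move=> iK iu ij gi; have [q [qK qi qu qj] [gq wq apexq]] := step i iK iu ij gi.
    have qE : q \in E by rewrite inE qK qu qj gq.
    exists q; split=> //; apply/subsetP => y; rewrite !inE -fvertsE.
    case/and3P => yK /eqP yi yE; rewrite yK yE andbT /=; apply/eqP/apexq => //.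
    by apply: contraNneq yE => ->; apply: imset_f.
  have [q0 [q0E _ _]] := stepE i0 i0K i0u i0j gi0.
  case: (arg_maxnP (fun i => #|Z i|) q0E) => i iE0 imax; have iE : i \in E := iE0.
  pose C := [set k in E | Z k == Z i].
  have CE k : k \in C -> k \in E by rewrite in_set => /andP[].
  have CK : C \subset K by apply/subsetP => k /CE /EP[].
  have C2 : (1 < #|C|)%N.
    have [iK iu ij gi _] := EP i iE; have [q [qE qi Ziq]] := stepE i iK iu ij gi.
    have ZE : Z i = Z q by apply/eqP; rewrite eqEcard Ziq; apply: imax.
    have inC k : k \in E -> Z i = Z k -> k \in C.
      by move=> kE e; rewrite in_set kE e eqxx.
    by apply/card_gt1P; exists i, q; split; rewrite 1?eq_sym // inC.
  have [|t [tK ti ti0]] := wit i; first by case: (EP i iE).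
  have iC : i \in C by rewrite in_set iE eqxx.
  have [|k /CE /EP[]//||] := @no_block K C t CK C2 _ NK _ tK.
  - move=> y k yK kC yk; have [/imsetP[l lE ->]|yE] := boolP (y \in w @: E).
      have [lC|lC] := boolP (l \in C); first by right; exists l.
      by left; rewrite w_fverts inE lC; case: (EP l lE).
    left; apply/in_fverts => l; rewrite inE negb_and negbK => /orP[lC|]; last exact/in_fverts.
    have : y \in Z l.
      have -> : Z l = Z k.
        by move: lC kC; rewrite !in_set => /andP[_ /eqP->] /andP[_ /eqP->].
      by rewrite in_set yK yk eqxx.
    by rewrite in_set => /and3P[_ /eqP].
  - move=> /in_fverts /(_ i); rewrite inE iC => /(_ isT) ti'.
    by move: ti0; rewrite ti' eqxx.
  case/imsetP => k _ tk; move: ti ti0; rewrite tk pwE (inj_eq w_inj) eq_sym.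
  by move=> /negPf->; rewrite eqxx.
(* the remaining case: the nonsimple vertices lie in the plane of u and j *)
have badall i : i \in K -> i != u -> i != j -> ~~ good i.
  by move=> iK iu ij; apply/negP => gi; apply: none; exists i.
have cP : #|[set u; j]| = 2%N by rewrite cards2 eq_sym ju.
have vN : v \notin fnonsimple K by apply/negP => /in_fnonsimple[_]; apply; apply: fsimple_v.
have wuN : w u \notin fnonsimple K by apply/negP => /in_fnonsimple[_]; apply.
have wuv : w u != v by rewrite eq_sym vw.
have K2 : (1 < #|K|)%N by rewrite -cP subset_leq_card.
have [K2'|K3] := leqP #|K| 2.
  have KE : K = [set u; j].
    by apply/esym/eqP; rewrite eqEcard PK cP.
  have : [set v; w u; w j; z] \subset fverts K.
    rewrite KE; apply/subsetP => y; rewrite !in_setU !in_set1 -!orbA.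
    by case/or4P => /eqP->; rewrite ?zP ?v_fverts ?w_fverts ?in_set2 ?eqxx ?orbT.
  move=> /subset_leq_card; apply/negP; rewrite -ltnNge.
  have c4 : #|[set v; w u; w j; z]| = 4%N.
    rewrite -!setUA !cardsU1 cards1 !in_setU1 !in_set1 !vw (inj_eq w_inj).
    by rewrite eq_sym (negPf zv) ![w _ == z]eq_sym !(negPf (zw _)) eq_sym (negPf ju).
  by rewrite c4; apply: leq_trans VK _; rewrite (leq_mul2l 2 _ 2) K2'.
have [i [iK iu ij]] : exists i, [/\ i \in K, i != u & i != j].
  have : ~~ (K \subset [set u; j]).
    by apply/negP => /subset_leq_card; rewrite cP leqNgt K3.
  by case/subsetPn => i iK; rewrite !inE negb_or => /andP[iu ij]; exists i.
have NP : fnonsimple K \subset fverts [set u; j].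
  apply/subsetP => x xN; apply/in_fverts => k; rewrite !inE negb_or => /andP[ku kj].
  have [kK|kK] := boolP (k \in K); last by case/in_fnonsimple: xN => /in_fverts/(_ k kK).
  have : x \in fnonsimple (K :\ k) by rewrite bad // badall.
  by case/in_fnonsimple => /in_fverts/(_ k); rewrite !inE eqxx => /(_ isT).
have NE : #|fnonsimple K| = #|K|.-1.
  have := badall i iK iu ij; rewrite /good -leqNgt bad ?badall // => le.
  have cK := cardsD1 i K; rewrite iK add1n in cK.
  by apply/eqP; rewrite eqn_leq cK /= le andbT -ltnS -cK.
have [x xN] : exists x, x \in fnonsimple K.
  by apply/set0Pn; rewrite -cards_eq0 NE -lt0n ltn_predRL.
case/in_fnonsimple: (xN) => _; apply.
apply: (plane_fsimple uK jK (subsetP NP x xN)).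
have /subset_leq_card le : v |: (w u |: fnonsimple K) \subset fverts [set u; j].
  by rewrite !subUset !sub1set v_fverts w_fverts !inE eqxx NP.
have e := cardsID (fverts [set u; j]) (fverts K); rewrite (setIidPr (fverts_sub PK)) in e.
move: le; rewrite !cardsU1 in_setU1 (negPf vN) (negPf wuN) vw NE /= !add1n.
rewrite (prednK (ltnW K2)) => le.
move: VK; rewrite -e mul2n -addnn => /(leq_ltn_trans (leq_add le (leqnn _))).
by rewrite addSnnS ltn_add2l.
Qed.

End Corner.

(** * Convex hulls of finite families *)

Section ConvexHulls.
Variables (R : realType) (n : nat).
Implicit Types (A P : set 'rV[R]_n) (x y : 'rV[R]_n).

Lemma convex_setE A : @convex_set R 'rV[R]_n A <->
  (forall x y t, A x -> A y -> 0 <= t -> t <= 1 -> A (t *: x + (1 - t) *: y)).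
Proof.
split=> [cA x y t Ax Ay t0 t1|cA x y t].
  exact: set_mem (cA x y (Itv01 t0 t1) (mem_set Ax) (mem_set Ay)).
move=> /set_mem Ax /set_mem Ay; apply: mem_set; exact: cA.
Qed.

Definition comb (I : finType) (a : I -> 'rV[R]_n) : set 'rV[R]_n :=
  fun x => exists c : I -> R,
    [/\ forall i, 0 <= c i, \sum_i c i = 1 & x = \sum_i c i *: a i].

Lemma comb_gen (I : finType) (a : I -> 'rV[R]_n) i : comb a (a i).
Proof.
exists (fun j => (j == i)%:R); split=> [j||]; first exact: ler0n.
  by rewrite (bigD1 i) //= eqxx big1 ?addr0 // => j /negPf->.
rewrite (bigD1 i) //= eqxx scale1r big1 ?addr0 // => j /negPf->.
by rewrite scale0r.
Qed.

Lemma comb_convex (I : finType) (a : I -> 'rV[R]_n) :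
  @convex_set R 'rV[R]_n (comb a).
Proof.
apply/convex_setE => x y t [c [c0 c1 ->]] [e [e0 e1 ->]] t0 t1.
exists (fun i => t * c i + (1 - t) * e i); split=> [i||].
- by rewrite addr_ge0 ?mulr_ge0 // subr_ge0.
- by rewrite big_split -!mulr_sumr c1 e1 /= !mulr1 addrC subrK.
rewrite !scaler_sumr -big_split; apply: eq_bigr => i _.
by rewrite /= [RHS]scalerDl !scalerA.
Qed.

Lemma comb_sub (I : finType) (a : I -> 'rV[R]_n) A :
  @convex_set R 'rV[R]_n A -> (forall i, A (a i)) -> forall x, comb a x -> A x.
Proof.
move=> /convex_setE cA Aa.
suff H k (S : {set I}) (c : I -> R) : #|S| = k -> (forall i, 0 <= c i) ->
    \sum_(i in S) c i = 1 -> A (\sum_(i in S) c i *: a i).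
  move=> x [c [c0 c1 ->]].
  have e (V : nmodType) (F : I -> V) : \sum_i F i = \sum_(i in [set: I]) F i.
    by apply: eq_bigl => i; rewrite inE.
  by rewrite e; apply: H; rewrite -?e.
elim: k S c => [|k IH] S c cS c0 c1.
  move/eqP: cS; rewrite cards_eq0 => /eqP S0; move: c1; rewrite S0 big_set0.
  by move/eqP; rewrite eq_sym oner_eq0.
have [m mS] : exists m, m \in S by apply/set0Pn; rewrite -cards_eq0 cS.
have cS' : #|S :\ m| = k by move: cS; rewrite (cardsD1 m) mS => -[].
rewrite (big_setD1 m) //=; move: c1; rewrite (big_setD1 m) //= => c1.
have s0 : 0 <= \sum_(i in S :\ m) c i by apply: sumr_ge0.
have [s00|sn0] := eqVneq (\sum_(i in S :\ m) c i) 0.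
  rewrite big1 => [|i iS].
    by move: c1; rewrite s00 !addr0 => ->; rewrite scale1r.
  have /psumr_eq0P h := s00.
  by rewrite (h _ i iS) ?scale0r // => j _.
set s := \sum_(i in S :\ m) c i in c1 s0 sn0 *.
have cm : c m = 1 - s by rewrite -c1 addrK.
rewrite addrC (_ : \sum_(i in _) _ = s *: \sum_(i in S :\ m) (c i / s) *: a i).
  rewrite cm; apply: cA => //; last by rewrite -subr_ge0 -cm.
  apply: IH => // [i|]; first by rewrite divr_ge0.
  by rewrite -mulr_suml mulfV.
rewrite scaler_sumr; apply: eq_bigr => i _; rewrite scalerA mulrCA mulfV //.
by rewrite mulr1.
Qed.

Lemma comb_trans (I J : finType) (a : I -> 'rV[R]_n) (b : J -> 'rV[R]_n) x :
  (forall j, comb a (b j)) -> comb b x -> comb a x.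
Proof. move=> h; apply: comb_sub h _; exact: comb_convex. Qed.

Lemma hull_comb (I : finType) (a : I -> 'rV[R]_n) :
  convex_hull (range a) = comb a.
Proof.
apply/seteqP; split.
  apply: smallest_sub; first exact: comb_convex.
  by move=> _ [i _ <-]; apply: comb_gen.
move=> x ax A [cA aA]; apply: (comb_sub cA) ax => i; apply: aA; exists i => //.
Qed.

Lemma comb_le (I : finType) (a : I -> 'rV[R]_n) (phi : 'cV[R]_n) b x :
  (forall i, ev phi (a i) <= b) -> comb a x -> ev phi x <= b.
Proof.
move=> h [c [c0 c1 ->]]; rewrite linear_sum -[leRHS]mul1r -c1 mulr_suml.
by apply: ler_sum => i _; rewrite /= evZ ler_wpM2l.
Qed.

Lemma comb_eq (I : finType) (a : I -> 'rV[R]_n) (phi : 'cV[R]_n) b (c : I -> R) :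
  (forall i, ev phi (a i) <= b) -> (forall i, 0 <= c i) -> \sum_i c i = 1 ->
  ev phi (\sum_i c i *: a i) = b -> forall i, c i != 0 -> ev phi (a i) = b.
Proof.
move=> h c0 c1 e i ci.
have : \sum_i c i * (b - ev phi (a i)) = 0.
  under eq_bigr do rewrite mulrBr.
  rewrite sumrB -mulr_suml c1 mul1r -[X in X - _]e linear_sum.
  by rewrite (eq_bigr (fun i => c i * ev phi (a i))) ?subrr // => j _; apply: evZ.
move/psumr_eq0P => /(_ (fun j _ => mulr_ge0 (c0 j) _)) h0.
have /eqP : c i * (b - ev phi (a i)) = 0.
  by apply: h0 => // j; rewrite subr_ge0.
by rewrite mulf_eq0 (negPf ci) subr_eq0 => /eqP.
Qed.

End ConvexHulls.

(** * Affine hulls and dimension *)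

Section AffineDimension.
Variables (R : realType) (n : nat).
Implicit Types (A P : set 'rV[R]_n) (x y : 'rV[R]_n).

Lemma affine_translate m (B : 'M[R]_(m, n)) x0 :
  affine_set (fun x => is_true (x - x0 <= B)%MS).
Proof.
move=> x y t hx hy.
have -> : t *: x + (1 - t) *: y - x0 = t *: (x - x0) + (1 - t) *: (y - x0).
  by rewrite !scalerBr addrACA -opprD -scalerDl addrCA subrr addr0 scale1r.
by rewrite addmx_sub // scalemx_sub.
Qed.

Lemma affine_hull_sub A m (B : 'M[R]_(m, n)) x0 :
  (forall x, A x -> (x - x0 <= B)%MS) ->
  forall x, affine_hull A x -> (x - x0 <= B)%MS.
Proof. move=> h; exact: (smallest_sub (@affine_translate m B x0) h). Qed.

Lemma affine_span A k x0 (b : 'I_k -> 'rV[R]_n) (c : 'I_k -> R) :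
  affine_set A -> A x0 ->
  (forall i, A (x0 + b i)) -> A (x0 + \sum_i c i *: b i).
Proof.
move=> aA A0 Ab; elim: k b c Ab => [|k IH] b c Ab; first by rewrite big_ord0 addr0.
rewrite big_ord_recl /=.
have line (s : R) i : A (x0 + s *: b i).
  have := aA _ _ s (Ab i) A0; congr A.
  by rewrite scalerDr addrAC -scalerDl addrCA subrr addr0 scale1r.
(* x0 + s + t is the midpoint of x0 + 2 s and x0 + 2 t *)
have A1 := line (2 * c ord0) ord0.
have A2 : A (x0 + \sum_(i < k) (2 * c (lift ord0 i)) *: b (lift ord0 i)).
  by apply: (IH (fun i => b (lift ord0 i)) (fun i => 2 * c (lift ord0 i))) => i.
have := aA _ _ 2^-1 A1 A2; congr A.
have -> : 1 - 2^-1 = 2^-1 :> R by lra.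
have -> : \sum_(i < k) (2 * c (lift ord0 i)) *: b (lift ord0 i) =
    2 *: \sum_(i < k) c (lift ord0 i) *: b (lift ord0 i).
  by rewrite scaler_sumr; apply: eq_bigr => i _; rewrite scalerA.
by apply/rowP => k'; rewrite !mxE; lra.
Qed.

Lemma has_dim_rows A k (B : 'M[R]_(k, n)) x0 : row_free B ->
  (forall x, A x -> (x - x0 <= B)%MS) -> A x0 -> (forall i, A (x0 + row i B)) ->
  has_dim k A.
Proof.
move=> fB AB A0 Ab; pose X := [tuple row i B | i < k].
have XE (i : 'I_k) : X`_i = row i B by rewrite -tnth_nth tnth_mktuple.
have memX x : (x \in <<X>>%VS) = (x <= B)%MS.
  apply/idP/submxP => [/coord_span ->|[D ->]].
    exists (\row_i coord X i x); rewrite mulmx_sum_row; apply: eq_bigr => i _.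
    by rewrite mxE XE.
  rewrite mulmx_sum_row; apply: memv_suml => i _; rewrite memvZ // memv_span //.
  by rewrite -XE mem_nth // size_tuple.
exists x0, <<X>>%VS; split; last first.
  have /eqP -> : free X.
    apply/freeP => c e i.
    have : (\row_i c i) *m B = 0 *m B.
      rewrite mul0mx -[RHS]e mulmx_sum_row; apply: eq_bigr => j _.
      by rewrite mxE XE.
    by move/(row_free_inj fB)/rowP/(_ i); rewrite !mxE.
  by rewrite size_tuple.
apply/seteqP; split=> x /=.
  by rewrite memX; apply: affine_hull_sub.
rewrite memX => /submxP[D e] A' [aA' AA'].
have -> : x = x0 + \sum_i D 0 i *: row i B by rewrite -mulmx_sum_row -e addrC subrK.
by apply: affine_span => // [|i]; apply: AA'.
Qed.

(** The direction space of the affine hull of A is contained in the row space of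
B. *)
Lemma has_dim_leq_rank A d m (B : 'M[R]_(m, n)) x0 : has_dim d A ->
  (forall x, A x -> (x - x0 <= B)%MS) -> (d <= \rank B)%N.
Proof.
move=> [x1 [W [hW dW]]] AB.
pose X := vbasis W; pose C := \matrix_(i < \dim W) X`_i.
have CB : (C <= B)%MS.
  apply/row_subP => i; rewrite rowK.
  have hB x : x - x1 \in W -> (x - x0 <= B)%MS.
    by move=> xW; apply: (affine_hull_sub AB); rewrite hW.
  have -> : X`_i = (x1 + X`_i - x0) - (x1 - x0).
    by rewrite opprB addrA subrK addrAC subrr add0r.
  rewrite addmx_sub // ?eqmx_opp hB ?subrr ?mem0v // addrAC subrr add0r.
  by apply: vbasis_mem; rewrite mem_nth // size_tuple.
rewrite (leq_trans _ (mxrankS CB)) // -dW row_leq_rank.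
apply: inj_row_free => u e; apply/rowP => i; rewrite mxE.
have /freeP := basis_free (vbasisP W); apply => //.
by rewrite -[RHS]e mulmx_sum_row; apply: eq_bigr => j _; rewrite rowK.
Qed.

Lemma has_dim_nonempty A d : has_dim d A -> exists x, A x.
Proof.
move=> [x0 [W [hW _]]]; apply: contrapT => /forallNP h.
have : affine_hull A x0 by rewrite hW /= subrr mem0v.
by apply: (@smallest_sub _ _ _ classical_sets.set0) => // x /h.
Qed.

End AffineDimension.

(** * Vertices, edges and generators of vertex cones *)

Section VerticesAndEdges.
Variables (R : realType) (n : nat).
Implicit Types (A P F : set 'rV[R]_n) (x y : 'rV[R]_n).

(** The points are distinct and each is a vertex of their convex hull. *)
Definition convex_position (I : finType) (p : I -> 'rV[R]_n) : Prop :=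
  forall i, pointed [set~ i] (fun j => p j - p i).

Lemma big_lift (W : nmodType) m (i : 'I_m) (G : 'I_m -> W) :
  \sum_(j in [set~ i]) G j = \sum_(k < m.-1) G (lift i k).
Proof.
case: m i G => [[]//|m] i G /=.
rewrite (reindex_omap (lift i) (unlift i)) => [|j]; last first.
  by rewrite !inE; case: unliftP => [k ->|->]; rewrite ?eqxx.
by apply: eq_bigl => k; rewrite !inE liftK eqxx andbT eq_sym neq_lift.
Qed.

(** In a spanning family of minimal size no point lies in the hull of the others. *)
Lemma polytope_comb P : polytope P ->
  exists m (p : 'I_m -> 'rV[R]_n), P = comb p /\ convex_position p.
Proof.
move=> [S [/finite_seqP[s ->] ->]].
pose spans m :=
  `[< exists p : 'I_m -> 'rV[R]_n, convex_hull [set` s]%classic = comb p >].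
have ex : exists m, spans m.
  exists (size s); apply/asboolP; exists (fun i => s`_i); rewrite -hull_comb.
  congr convex_hull; apply/seteqP; split=> [x /= xs|_ [i _ <-] /=].
    by exists (Ordinal (etrans (index_mem x s) xs)) => //=; rewrite nth_index.
  exact: mem_nth.
case: (ex_minnP ex) => m /asboolP[p hp] mmin; exists m, p; split=> // i c c0 e k ki.
apply: contrapT => /eqP ck.
have im : (m.-1 < m)%N by case: m i {p hp mmin c c0 e k ki ck} => [[]|].
have s_gt0 : 0 < \sum_(j in [set~ i]) c j.
  rewrite (bigD1 k) //= ltr_pwDl // ?lt_neqAle 1?eq_sym ?ck ?c0 //.
  exact: sumr_ge0.
set t := \sum_(j in _) c j in s_gt0.
have pi : comb (p \o lift i) (p i).
  exists (fun k => c (lift i k) / t); split=> [l||].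
  - by rewrite divr_ge0 // ltW.
  - by rewrite -mulr_suml -big_lift mulfV // gt_eqF.
  transitivity (\sum_(j in [set~ i]) (c j / t) *: p j); last exact: big_lift.
  have : \sum_(j in [set~ i]) c j *: p j = t *: p i.
    move: e; under eq_bigr do rewrite scalerBr.
    by rewrite sumrB -scaler_suml => /eqP; rewrite subr_eq0 => /eqP.
  move/(congr1 ( *:%R t^-1)); rewrite scalerA mulVf ?gt_eqF // scale1r => <-.
  by rewrite scaler_sumr; apply: eq_bigr => j _; rewrite scalerA mulrC.
have : (m <= m.-1)%N.
  apply: mmin; apply/asboolP; exists (p \o lift i); rewrite hp.
  apply/seteqP; split=> x; apply: comb_trans => j; last exact: comb_gen.
  case: (unliftP i j) => [l ->|->//]; exact: (comb_gen (p \o lift i)).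
by rewrite leqNgt im.
Qed.

Section Fixed.
Variables (I : finType) (p : I -> 'rV[R]_n).
Hypothesis pp : convex_position p.

Lemma convex_position_inj : injective p.
Proof.
move=> j i e; apply: contrapT => /eqP ji.
have /(_ (fun k => (k == j)%:R)) := @pp i.
move=> /(_ (fun k => ler0n _ _)) h; have /eqP : (j == j)%:R = 0 :> R.
  apply: h; last by rewrite !inE.
  rewrite big1 // => k _; case: eqP => [->|_]; last by rewrite scale0r.
  by rewrite e subrr scaler0.
by rewrite eqxx oner_eq0.
Qed.

(** A point p i is exposed by [gordan] with g = 0; conversely a functional attaining
its maximum over the hull at one point only attains it at some p j. *)
Lemma vertices_comb : vertices (comb p) = range p.
Proof.
apply/seteqP; split=> v; last first.
  case=> i _ <-; split; last first.
    have f0 : row_free (0 : 'M[R]_(0, n)) by rewrite /row_free mxrank0.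
    apply: (has_dim_rows (x0 := p i) f0) => // [x /= ->|[]//].
    by rewrite subrr sub0mx.
  have [phi _ phi_gt0] : exists2 phi : 'cV[R]_n, ev phi 0 = 0 &
      forall j, j \in [set~ i] -> 0 < ev phi (p j - p i).
    by apply: gordan => c t c0; rewrite scaler0; apply: pp.
  have le j : ev (- phi) (p j) <= ev (- phi) (p i).
    rewrite !evNl lerN2 -subr_ge0 -linearB /=.
    have [->|ji] := eqVneq j i; first by rewrite subrr linear0.
    by apply/ltW/phi_gt0; rewrite !inE.
  exists (- phi), (ev (- phi) (p i)); split=> [x|]; first exact: comb_le.
  apply/seteqP; split=> x /=; first by move=> ->; split=> //; apply: comb_gen.
  case=> -[c [c0 c1 ->]] e; have h := comb_eq le c0 c1 e.
  have ci j : j != i -> c j = 0.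
    move=> ji; apply: contrapT => /eqP /h; apply/eqP.
    by rewrite !evNl eqr_opp -subr_eq0 -linearB gt_eqF ?phi_gt0 ?inE.
  rewrite (bigD1 i) //= [X in _ + X]big1 ?addr0 => [|j ji]; last by rewrite ci ?scale0r.
  by move: c1; rewrite (bigD1 i) //= [X in _ + X]big1 ?addr0 // => ->; rewrite scale1r.
case=> -[phi [b [le Fe]]] _.
have [[c [c0 c1 ve]] vb] : comb p v /\ ev phi v = b.
  have : ([set v] : set _)%classic v by [].
  by rewrite Fe.
have [j cj] : exists j, c j != 0.
  apply: contrapT => /forallNP h; move: c1; rewrite big1 => [|j _].
    by move/eqP; rewrite eq_sym oner_eq0.
  by apply/eqP/negPn/negP; apply: h.
exists j => //; have : ([set v] : set _)%classic (p j).
  rewrite Fe; split; first exact: comb_gen.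
  by rewrite ve in vb; apply: (comb_eq _ c0 c1 vb cj) => k; apply: le; apply: comb_gen.
by [].
Qed.

Lemma comb_cone (M : {set I}) i x :
  (forall j, cone M (fun g => p g - p i) (p j - p i)) -> comb p x ->
  cone M (fun g => p g - p i) (x - p i).
Proof.
move=> Mg [c [c0 c1 ->]].
have -> : \sum_j c j *: p j - p i = \sum_j c j *: (p j - p i).
  by under [RHS]eq_bigr do rewrite scalerBr; rewrite sumrB -scaler_suml c1 scale1r.
elim/big_ind: _ => [|y z|j _]; [exact: cone0|exact: coneD|].
exact: coneZ.
Qed.

(** A minimal generator g spans an exposed ray of the cone at p i, and the edge is the
intersection of the polytope with that ray. *)
Lemma generator_edge (M : {set I}) i g : i \notin M ->
  (forall k, cone M (fun j => p j - p i) (p k - p i)) ->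
  (forall j, j \in M -> ~ cone (M :\ j) (fun j => p j - p i) (p j - p i)) ->
  g \in M ->
  exists e : set 'rV[R]_n, [/\ incident_edges (comb p) (p i) e, e (p g) &
    forall x, e x -> exists2 t, 0 <= t & x - p i = t *: (p g - p i)].
Proof.
move=> iM Mg Mm gM; pose h j := p j - p i.
have MS : M \subset [set~ i].
  by apply/subsetP => j jM; rewrite !inE; apply: contraNneq iM => <-.
have pM : pointed M h := pointed_sub MS (@pp i).
have [phi phig phi_gt0] := gordan (minimal_indep pM gM (Mm g gM)).
have phi_ge0 j : j \in M -> 0 <= ev phi (h j).
  move=> jM; have [->|jg] := eqVneq j g; first by rewrite phig.
  by apply/ltW/phi_gt0; rewrite !inE jg.
have le j : ev (- phi) (p j) <= ev (- phi) (p i).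
  rewrite !evNl lerN2 -subr_ge0 -linearB /=; have [c c0 ->] := Mg j.
  by rewrite ev_sum sumr_ge0 // => k kM; rewrite mulr_ge0 ?phi_ge0.
pose e : set 'rV[R]_n :=
  [set x | comb p x /\ (x *m - phi) 0 0 = ev (- phi) (p i)]%classic.
have epi : e (p i) by split=> //; apply: comb_gen.
have epg : e (p g).
  split; first exact: comb_gen.
  rewrite -/(ev _ _) !evNl; congr (- _); apply/eqP.
  by rewrite -subr_eq0 -linearB /= phig.
have eray x : e x -> exists2 t, 0 <= t & x - p i = t *: (p g - p i).
  case=> /(comb_cone Mg)[c c0 xe]; rewrite -/(ev _ _) !evNl => /oppr_inj /eqP.
  rewrite -subr_eq0 -linearB /= xe ev_sum => /eqP /psumr_eq0P z.
  exists (c g) => //; rewrite (big_setD1 g) //= big1 ?addr0 // => j jMg.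
  have jM : j \in M by case/setD1P: jMg.
  have /eqP : c j * ev phi (h j) = 0.
    by apply: z => // k kM; rewrite mulr_ge0 ?phi_ge0.
  rewrite mulf_eq0 => /orP[/eqP->|/eqP e0]; first by rewrite scale0r.
  by have := phi_gt0 j jMg; rewrite -/(h j) e0 ltxx.
exists e; split=> //; split=> //; split.
  exists (- phi), (ev (- phi) (p i)); split=> // x; exact: comb_le.
apply: (has_dim_rows (B := h g) (x0 := p i)) => //.
- rewrite /row_free rank_rV /h subr_eq0 (inj_eq convex_position_inj).
  by rewrite (_ : g != i) //; apply: contraNneq iM => <-.
- by move=> x /eray[t _ ->]; apply: scalemx_sub.
- by move=> k; rewrite ord1 row_id /h addrC subrK.
Qed.

End Fixed.

Lemma card_set_le (I : finType) (T : Type) (S : set T) (f : I -> T) (N : {set I}) m :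
  {in N &, injective f} -> (forall i, i \in N -> S (f i)) -> (S #<= `I_m%classic)%card ->
  (#|N| <= m)%N.
Proof.
move=> finj fS /pcard_leP[g].
have gS i : i \in N -> (g (f i) < m)%N by move=> /fS /(@funS _ _ _ _ g).
case: m g gS => [|m] g gS.
  rewrite leqn0 cards_eq0; apply/eqP/setP => i; rewrite inE.
  by apply/negP => /gS.
rewrite -[m.+1]card_ord -(@card_in_imset _ _ (fun i => inord (g (f i)) : 'I_m.+1)).
  exact: max_card.
move=> i j iN jN /(congr1 val) /=; rewrite !inordK ?gS //.
move=> e; apply: finj => //; apply: (@inj _ _ _ g) e; apply: mem_set; exact: fS.
Qed.

(** Distinct minimal generators lie on distinct edges, since neither is a multiple of
the other; so there are at most as many as edges. *)
Lemma simple_generators (I : finType) (p : I -> 'rV[R]_n) d i :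
  convex_position p -> simple_vertices d (comb p) (p i) ->
  exists2 M : {set I}, (#|M| <= d)%N &
    forall k, cone M (fun g => p g - p i) (p k - p i).
Proof.
move=> pp [_ simple_i].
have [M [MS Mgen Mmin]] := minimal_generators [set~ i] (fun g => p g - p i).
have iM : i \notin M by apply/negP => /(fintype.subsetP MS); rewrite !inE eqxx.
have Mg k : cone M (fun g => p g - p i) (p k - p i).
  have [->|ki] := eqVneq k i; first by rewrite subrr; apply: cone0.
  by apply: Mgen; rewrite !inE.
exists M => //.
have /choice[e eP] : forall g, exists e : set 'rV[R]_n, g \in M ->
    [/\ incident_edges (comb p) (p i) e, e (p g) &
    forall x, e x -> exists2 t, 0 <= t & x - p i = t *: (p g - p i)].
  move=> g; have [gM|_] := boolP (g \in M); last by exists (comb p).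
  by have [e eP] := generator_edge pp iM Mg Mmin gM; exists e.
apply: (@card_set_le _ _ (incident_edges (comb p) (p i)) e).
- move=> g g' gM g'M ee; apply: contrapT => /eqP gg'.
  have [_ eg _] := eP g gM; have [_ _ er] := eP g' g'M.
  have [t t0 tE] : exists2 t, 0 <= t & p g - p i = t *: (p g' - p i).
    by apply: er; rewrite -ee.
  apply: (Mmin g gM); rewrite tE; apply: coneZ => //.
  by apply: (cone_gen (fun g => p g - p i)); rewrite !inE g'M eq_sym gg'.
- by move=> g /eP[].
- by have := simple_i; rewrite card_eq_le => /andP[].
Qed.

End VerticesAndEdges.

(** * Affine coordinates at a simple vertex, and the pyramid *)

Section Coordinates.
Variables (R : realType) (n k : nat) (I : finType) (p : I -> 'rV[R]_n).
Variables (v : I) (w : 'I_k.+1 -> I) (q : I -> 'rV[R]_k.+1).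
Hypothesis pp : convex_position p.
Let W := \matrix_l (p (w l) - p v).
Hypothesis W_free : row_free W.
Hypothesis qE : forall i, p i - p v = q i *m W.
Hypothesis q_ge0 : forall i l, 0 <= q i 0 l.

Lemma coord_origin : q v = 0.
Proof. by apply: (row_free_inj W_free); rewrite -qE subrr mul0mx. Qed.

Lemma coord_axis l : q (w l) = delta_mx 0 l.
Proof. by apply: (row_free_inj W_free); rewrite -qE -rowE rowK. Qed.

Lemma coord_diff x y : p x - p y = (q x - q y) *m W.
Proof. by rewrite mulmxBl -!qE opprB addrA subrK. Qed.

Lemma coord_cone (M : {set I}) x y : cone M (fun g => p g - p x) (p y - p x) ->
  cone M (fun g => q g - q x) (q y - q x).
Proof.
move=> [c c0 e]; exists c => //; apply: (row_free_inj W_free).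
rewrite -coord_diff e mulmx_suml; apply: eq_bigr => g _.
by rewrite coord_diff scalemxAl.
Qed.

Lemma coord_position : convex_position q.
Proof.
move=> i c c0 e j ji; apply: (pp c0) ji.
have := congr1 (mulmx^~ W) e; rewrite mul0mx => {2}<-.
by rewrite mulmx_suml; apply: eq_bigr => g _; rewrite coord_diff scalemxAl.
Qed.

(** The facet is where the coordinate j vanishes; as a functional on the ambient space
this coordinate is obtained from a right inverse of the basis W. *)
Lemma apex_pyramid j : has_dim k.+1 (comb p) ->
  (forall i, i != w j -> q i 0 j = 0) -> pyramid (comb p).
Proof.
move=> dimP apex; have [B WB] := row_freeP W_free.
pose phi : 'cV[R]_n := - (B *m delta_mx j 0).
have phiE i : ev phi (p i) = ev phi (p v) - q i 0 j.
  rewrite -[p i](subrK (p v)) linearD /= addrC qE; congr (_ + _).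
  rewrite /phi evNl /ev mulmxA -(mulmxA _ W) WB mulmx1 -colE mxE.
  by [].
have le i : ev phi (p i) <= ev phi (p v) by rewrite phiE gerBl.
pose F : set 'rV[R]_n := [set x | comb p x /\ (x *m phi) 0 0 = ev phi (p v)]%classic.
have Fp i : i != w j -> F (p i).
  move=> ij; split; first exact: comb_gen.
  by rewrite -/(ev _ _) phiE apex // subr0.
have Fv : F (p v).
  by apply: Fp; apply: contra_neq (oner_neq0 R) => vj; have := coord_axis j;
    rewrite -vj coord_origin => /rowP/(_ j); rewrite !mxE !eqxx.
have pw l : p v + (p (w l) - p v) = p (w l) by rewrite addrC subrK.
pose W' := rowsub (lift j) W.
have W'E l : row l W' = p (w (lift j l)) - p v by rewrite row_rowsub rowK.
have FW' x : F x -> (x - p v <= W')%MS.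
  case=> -[c [c0 c1 ->]] e; have h := comb_eq le c0 c1 e.
  have -> : \sum_i c i *: p i - p v = \sum_i c i *: (p i - p v).
    by under [RHS]eq_bigr do rewrite scalerBr; rewrite sumrB -scaler_suml c1 scale1r.
  apply: summx_sub => i _; have [->|ci] := eqVneq (c i) 0.
    by rewrite scale0r sub0mx.
  have qj : q i 0 j = 0.
    have /eqP := h i ci; rewrite phiE -subr_eq0 addrAC subrr sub0r oppr_eq0.
    by move/eqP.
  apply: scalemx_sub; rewrite qE mulmx_sum_row; apply: summx_sub => l _.
  case: (unliftP j l) => [l' ->|->]; last by rewrite qj scale0r sub0mx.
  by apply: scalemx_sub; rewrite rowK -W'E row_sub.
have W'free : row_free W'.
  apply: inj_row_free => u u0.
  have : (\sum_l u 0 l *: (delta_mx 0 (lift j l) : 'rV[R]_k.+1)) *m W = 0 *m W.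
    rewrite [RHS]mul0mx -[RHS]u0 mulmx_suml mulmx_sum_row; apply: eq_bigr => l _.
    by rewrite -scalemxAl -rowE W'E rowK.
  move/(row_free_inj W_free)/rowP => e; apply/rowP => l; have := e (lift j l).
  rewrite summxE !mxE (bigD1 l) //= !mxE !eqxx mulr1 big1 ?addr0 // => l' /negPf ll'.
  by rewrite !mxE eqxx (inj_eq lift_inj) eq_sym ll' mulr0.
have Ffacet : facet (comb p) F.
  exists k; split=> //; split.
    by exists phi, (ev phi (p v)); split=> // x; apply: comb_le.
  apply: (has_dim_rows W'free FW') => // l.
  rewrite W'E pw; apply: Fp; apply: contra_neq (oner_neq0 R) => e.
  have /rowP/(_ j) := coord_axis j; rewrite -e coord_axis.
  by rewrite !mxE !eqxx (negPf (neq_lift j l)) => /esym.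
exists F, (p (w j)); split=> //.
- by rewrite vertices_comb.
- case=> _; rewrite -/(ev _ _) phiE coord_axis mxE !eqxx => /eqP.
  by rewrite -subr_eq0 addrAC subrr sub0r oppr_eq0 oner_eq0.
apply/seteqP; split=> [x|].
  move=> px A [cA FA]; apply: (comb_sub cA) px => i; apply: FA.
  by have [->|ij] := eqVneq i (w j); [right|left; apply: Fp].
apply: smallest_sub; first exact: comb_convex.
by move=> x [[]//|->]; apply: comb_gen.
Qed.

End Coordinates.

Local Open Scope classical_set_scope.
Local Open Scope card_scope.
Local Open Scope ring_scope.

Theorem theorem9 (R : realType) (n d m : nat) (P : set 'rV[R]_n)
    (hP : dpolytope d P)
    (hm : vertices P #= `I_m) (hm2d : (m < 2 * d)%N)
    (hns : nonsimple_vertices d P #<= `I_(d - 1)) :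
  pyramid P.
Proof.
case: d => [|k] in hP hm2d hns *; first by rewrite muln0 in hm2d.
rewrite subSS subn0 in hns.
have [polP dimP] := hP; have [M0 [p [PE pp]]] := polytope_comb polP.
rewrite {}PE in hm hns dimP *; clear P hP polP.
have injp := convex_position_inj pp.
have vertp i : vertices (comb p) (p i) by rewrite vertices_comb //; exists i.
pose nonsimple := [set i | ~~ `[< simple_vertices k.+1 (comb p) (p i) >]]%SET.
have cardN : (#|nonsimple| <= k)%N.
  apply: (card_set_le _ _ hns (f := p)); first exact: in2W injp.
  by move=> i; rewrite inE => /asboolPn ns; split.
have cardI : (#|'I_M0| <= m)%N.
  rewrite -cardsT; apply: (card_set_le (S := vertices (comb p)) (f := p)) => //.
    exact: in2W injp.
  by move: hm; rewrite card_eq_le => /andP[].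
have hull_row r (B : 'M[R]_(r, n)) i : (forall j, (p j - p i <= B)%MS) ->
    (k.+1 <= \rank B)%N.
  move=> pB; apply: (has_dim_leq_rank (x0 := p i) dimP) => x [c [_ c1 ->]].
  have -> : \sum_j c j *: p j - p i = \sum_j c j *: (p j - p i).
    by under [RHS]eq_bigr do rewrite scalerBr; rewrite sumrB -scaler_suml c1 scale1r.
  by apply: summx_sub => j _; apply: scalemx_sub.
have card_gt : (k.+1 < #|'I_M0|)%N.
  have [x [c [_ c1 _]]] := has_dim_nonempty dimP.
  have [i _] : exists i : 'I_M0, true.
    apply: contrapT => /forallNP h; move: c1; rewrite big1 => [|i]; last by case: (h i).
    by move/eqP; rewrite eq_sym oner_eq0.
  rewrite -cardsT (cardsD1 i) inE add1n ltnS setTD.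
  apply: leq_trans (rank_leq_row (family [set~ i]%SET (fun j => p j - p i))).
  apply: (hull_row _ _ i) => j; have [->|ji] := eqVneq j i.
    by rewrite subrr sub0mx.
  by apply: (family_sub (fun j => p j - p i)); rewrite !inE.
have [v vs] : exists v, simple_vertices k.+1 (comb p) (p v).
  apply: contrapT => /forallNP h; have : nonsimple = [set: 'I_M0]%SET.
    by apply/setP => i; rewrite !inE; apply/asboolPn; apply: h.
  move=> e; move: cardN; rewrite e cardsT leqNgt => /negP; apply.
  exact: ltn_trans card_gt.
have [M Mk Mg] := simple_generators pp vs.
have cM : #|M| = k.+1.
  apply/eqP; rewrite eqn_leq Mk /=.
  apply: leq_trans (rank_leq_row (family M (fun j => p j - p v))).
  by apply: (hull_row _ _ v) => j; apply: cone_family.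
pose w (l : 'I_k.+1) := enum_val (cast_ord (esym cM) l).
have sumM (U : nmodType) (G : 'I_M0 -> U) : \sum_(g in M) G g = \sum_l G (w l).
  rewrite big_enum_val (reindex (cast_ord (esym cM))) //=.
  by exists (cast_ord cM) => l _; rewrite ?cast_ordK ?cast_ordKV.
have /choice[c cE] : forall i, exists c : 'I_M0 -> R, (forall j, 0 <= c j) /\
    p i - p v = \sum_(g in M) c g *: (p g - p v).
  by move=> i; have [c c0 e] := Mg i; exists c.
pose q i := \row_l c i (w l).
pose W := \matrix_l (p (w l) - p v).
have qE i : p i - p v = q i *m W.
  have [_ ->] := cE i; rewrite sumM mulmx_sum_row; apply: eq_bigr => l _.
  by rewrite mxE rowK.
have q_ge0 i l : 0 <= q i 0 l by rewrite mxE; case: (cE i).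
have W_free : row_free W.
  rewrite -row_leq_rank; apply: (hull_row _ _ v) => j; rewrite qE; exact: submxMl.
have VT i : i \in fverts q [set: 'I_k.+1]%SET by apply/in_fverts => l; rewrite inE.
have cardV : (#|fverts q [set: 'I_k.+1]%SET| < 2 * #|[set: 'I_k.+1]%SET|)%N.
  rewrite cardsT card_ord; apply: leq_ltn_trans hm2d.
  by apply: leq_trans cardI; apply: max_card.
have cardNq : (#|fnonsimple q [set: 'I_k.+1]%SET| < #|[set: 'I_k.+1]%SET|)%N.
  rewrite cardsT card_ord ltnS; apply: leq_trans cardN; apply: subset_leq_card.
  apply/fintype.subsetP => i /in_fnonsimple[_ ns]; rewrite inE; apply/asboolPn => si.
  apply: ns; have [M' M'k M'g] := simple_generators pp si.
  exists M'; rewrite cardsT card_ord; split=> // [|y _].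
    by apply/fintype.subsetP => x _; apply: VT.
  by apply: (coord_cone W_free qE); apply: M'g.
have [j _ apex] := apex_exists (coord_position pp qE)
  (coord_origin W_free qE) (coord_axis W_free qE) q_ge0 cardV cardNq.
apply: (apex_pyramid pp W_free qE q_ge0 dimP (j := j)) => i ij.
exact: apex.
Qed.
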